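(* Let $n\ge 1$, let $m_1,\dots,m_n$ be nonnegative integers, $|m|=m_1+\dots+m_n$, and let $a,b,c,d,e,z_1,\dots,z_n$ be nonzero complex numbers with $a^2q^{1+|m|}=bcde$. Then $$\sum_{y_1=0}^{m_1}\cdots\sum_{y_n=0}^{m_n} \Bigg(\frac{\Delta(zq^y)}{\Delta(z)}\prod_{k=1}^n\frac{\theta(az_kq^{y_k+|y|})} {\theta(az_k)}\cdot\frac{(b,c)_{|y|}}{(aq/d,aq/e)_{|y|}} \prod_{j=1}^n\frac{(az_j)_{|y|}}{(aq^{1+m_j}z_j)_{|y|}}\,q^{|y|}$$ $$\times\prod_{k=1}^n\frac{(dz_k,ez_k)_{y_k}}{(aqz_k/b,aqz_k/c)_{y_k}} \prod_{j,k=1}^n\frac{(q^{-m_j}z_k/z_j)_{y_k}}{(qz_k/z_j)_{y_k}}\Bigg) =\frac{(aq/cd,aq/bd)_{|m|}}{(aq/d,aq/bcd)_{|m|}} \prod_{k=1}^n\frac{(aqz_k,aqz_k/bc)_{m_k}}{(aqz_k/b,aqz_k/c)_{m_k}}.$$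
   Context: Fix $p\in\mathbb C$ with $|p|<1$ and $q\in\mathbb C\setminus\{0\}$. For $x\neq 0$ put $\theta(x)=\prod_{j=0}^\infty(1-p^jx)(1-p^{j+1}/x)$ (so $\theta(x)=1-x$ when $p=0$). The elliptic Pochhammer symbol is $(a)_k=\theta(a)\theta(aq)\cdots\theta(aq^{k-1})$ for integers $k\ge 0$, with $(a)_0=1$, and $(a_1,\dots,a_r)_k=(a_1)_k\cdots(a_r)_k$. In arguments, everything after the slash is in the denominator, e.g. $aq/bcd$ means $aq/(bcd)$. For $z=(z_1,\dots,z_n)$, the elliptic Vandermonde determinant is $\Delta(z)=\prod_{1\le j<k\le n}z_j\,\theta(z_k/z_j)$, and $zq^y=(z_1q^{y_1},\dots,z_nq^{y_n})$, $|y|=y_1+\dots+y_n$. Standing assumption: all expressions are well-defined, i.e. the parameters are such that no denominator occurring on either side vanishes. *)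

(* Defs.v *)
From HB Require Import structures.
From mathcomp Require Export all_boot all_order all_algebra.
From mathcomp Require Export all_classical all_reals all_analysis.
From mathcomp Require Export complex.

Set Implicit Arguments.
Unset Strict Implicit.
Unset Printing Implicit Defensive.

Import Order.TTheory GRing.Theory Num.Theory.
Import numFieldNormedType.Exports.

Local Open Scope classical_set_scope.
Local Open Scope ring_scope.

(* The definitions take any [C : numClosedFieldType], because this is the level
   at which the norm topology, hence [lim], is available; they are meant to be
   used with [C := R[i]], [R : realType]. *)

(* For [`|p| < 1] and [x != 0] the partial products converge in [R[i]], so
   [lim] is the value of the infinite product.  Since [0 ^+ 0 = 1], for [p = 0]
   this is [1 - x]. *)
Definition theta (C : numClosedFieldType) (p x : C) : C :=
  lim ((fun N : nat =>
    \prod_(0 <= j < N) ((1 - p ^+ j * x) * (1 - p ^+ j.+1 / x))) @ \oo).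

Definition epoch (C : numClosedFieldType) (p q a : C) (k : nat) : C :=
  \prod_(0 <= i < k) theta p (a * q ^+ i).

(* (a_1, ..., a_r)_k, with [s] the list of the a_i *)
Definition epochs (C : numClosedFieldType) (p q : C) (s : seq C) (k : nat) : C :=
  \prod_(a <- s) epoch p q a k.

Definition evandermonde (C : numClosedFieldType) (p : C) (n : nat)
    (z : 'I_n -> C) : C :=
  \prod_(j < n) \prod_(k < n | (j < k)%N) (z j * theta p (z k / z j)).

(* Main.v *)
Require Import Defs.
From mathcomp Require Import all_boot all_order all_algebra.
From mathcomp Require Import all_classical all_reals all_analysis.
From mathcomp Require Import complex.
From mathcomp Require Import ring lra zify.
Import Order.TTheory GRing.Theory Num.Theory.
Import numFieldNormedType.Exports.
Local Open Scope ring_scope.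

Set Implicit Arguments.
Unset Strict Implicit.
Unset Printing Implicit Defensive.

(* Clear the denominators that involve b and c and keep l = bc fixed.  Both sides
   then lie in the span of the products of |m| functions theta(uc) theta(ul/c) of
   c, and by the addition formula for theta such a function is determined by its
   values at |m|+1 points c, generically distinct.  At c = 1 only the term y = 0
   survives.  At c = a q^s z_k, 1 <= s <= m_k, only the terms with y_k >= s do, and
   the identity becomes, up to a common factor, the one for m_k - s, z_k q^s, a q^s
   and b q^s: induction on |m|.  Non-generic parameters are limits of generic ones
   z_k t, t -> 1, a rescaling that preserves the balancing condition.

   The addition formula says that theta(xy) theta(x/y) / x, which is antisymmetric,
   has rank 2 as a kernel in x and y, so that its Pfaffians of order 4 vanish.
   Rank 2 is visible on the Laurent series of theta (Jacobi's triple product,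
   obtained here as a limit of the q-binomial theorem): in
   sum_(m,n) (-1)^(m+n) p^(C(m,2)+C(n,2)) x^(m+n) y^(m-n) put m = s+t+e, n = s-t
   with e = 0 or 1. *)

(** With l = bc fixed, every function theta(uc) theta(ul/c) is invariant under c -> l/c. Nodes must
    therefore be distinct modulo this symmetry too: the kernel contains theta(xy/l) beside
    theta(x/y), and at the nodes this gives arguments a^2 z_j z_k q^i / l, which occur in no
    denominator of the theorem. Hence the detour through generic parameters. Scaling all z_k by t
    fixes the quotients z_j/z_k, on which nothing has to be gained, and multiplies the arguments to
    be made generic by t or t^2.

    For the addition formula, the partial products of theta are Laurent polynomials whose q-binomial
    coefficients depend on the summation index, whereas the substitution for (m,n) separates x from
    y only if they are constant. At stage N they are replaced by one constant, with an error of
    order N^2 r^N for some r < 1. What passes to the limit is not the decomposition into two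
    products but a closed condition, the vanishing of the 3 by 3 determinants. The Pfaffian is then
    a factor of such a determinant. *)

(* [field] does not see through powers with a variable exponent: they become
   atoms, known to be nonzero. *)
Ltac field_pow x x0 := rewrite ?exprD ?exprS ?expr0 ?expr1;
  repeat match goal with |- context[x ^+ ?k] =>
    let Q := fresh "Q" in let hQ := fresh "hQ" in
    have hQ : x ^+ k != 0 by [rewrite expf_neq0];
    move: (x ^+ k) hQ => Q hQ end;
  field; repeat first [apply/andP; split | apply: mulf_neq0]; rewrite ?oner_neq0; by [].

(** * Interpolation with a three-term relation *)

Section Interpolation.
Variables (F : fieldType) (U : Type) (T : eqType).
Variables (D : pred T) (E : U -> bool).
Variables (H : U -> T -> F) (K : T -> T -> F).
Hypothesis K_anti : forall x y, D x -> D y -> K x y = - K y x.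
Hypothesis three_term : forall u x y y0, E u -> D x -> D y -> D y0 ->
  H u x * K y y0 = H u y * K x y0 - H u y0 * K x y.

(** [three_term] is the case of one function and two nodes. In the induction the product over [us]
    is interpolated on [ys] both at [x] and at [y0]; [three_term] splits [H u x] into a multiple of
    [H u y] and one of [H u y0], and the second parts add up to the term of the new node [y0]. *)
Lemma lagrange (us : seq U) (nodes : seq T) (x : T) :
  size nodes = (size us).+1 -> uniq nodes -> all D nodes -> all E us ->
  {in nodes &, forall y y', y != y' -> K y y' != 0} -> D x ->
  \prod_(u <- us) H u x =
  \sum_(y <- nodes) (\prod_(u <- us) H u y)
    * \prod_(j <- nodes | j != y) (K x j / K y j).
Proof.
elim: us nodes x => [|u us IH] [|y0 ys] x //= [szE].
  case: ys szE => [|? ?] //= _ _ _ _ _ _.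
  by rewrite big_seq1 big_cons eqxx /= !big_nil mulr1.
move=> /andP[y0ys uys] /andP[Dy0 Dys] /andP[Eu Eus] Kn Dx.
have Kys : {in ys &, forall y y', y != y' -> K y y' != 0}.
  by move=> y y' hy hy'; apply: Kn; rewrite inE ?hy ?hy' orbT.
have Ky0 y : y \in ys -> K y y0 != 0.
  move=> hy; apply: Kn; rewrite ?inE ?eqxx ?hy ?orbT //.
  by apply: contraNneq y0ys => <-.
have y0N y : y \in ys -> (y0 != y) by move=> hy; apply: contraNneq y0ys => ->.
have K0y y : y \in ys -> K y0 y != 0.
  by move=> hy; apply: Kn; rewrite ?inE ?eqxx ?hy ?orbT // y0N.
rewrite big_cons (IH ys) // mulr_sumr [RHS]big_cons !big_cons eqxx /=.
have -> : \prod_(j <- ys | j != y0) (K x j / K y0 j) =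
          \prod_(j <- ys) (K x j / K y0 j).
  by rewrite big_seq_cond [RHS]big_seq; apply: eq_bigl => j; case: (boolP (j \in ys)) => //= /y0N; rewrite eq_sym.
rewrite (IH ys y0) //.
rewrite mulr_sumr mulr_suml -big_split /=.
apply: eq_big_seq => y hy.
rewrite !big_cons (y0N y hy) /=.
have Dy : D y by move/allP: Dys; apply.
have tt := three_term Eu Dx Dy Dy0.
(* The weight of [y0] at [x] times the weight of [y] at [y0]: all [K y0 j] cancel except the one
   with [j = y]. *)
have eqj : \prod_(j <- ys) (K x j / K y0 j) * \prod_(j <- ys | j != y) (K y0 j / K y j) =
   K x y / K y0 y * \prod_(j <- ys | j != y) (K x j / K y j) :> F.
  rewrite (bigD1_seq y) //= -[LHS]mulrA; congr (_ * _).
  rewrite -big_split /=; rewrite big_seq_cond [RHS]big_seq_cond; apply: eq_bigr => j /andP[hj jy].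
  by field; rewrite K0y // Kys // eq_sym.
rewrite (K_anti Dy0 Dy) in eqj.
set P := \prod_(j <- us) _.
set Q := \prod_(j <- ys | _) (K x j / K y j) in eqj *.
transitivity (H u x * K y y0 * P * Q / K y y0); first by field; rewrite Ky0.
rewrite tt.
transitivity (H u y * P * (K x y0 / K y y0 * Q) +
  H u y0 * P * (\prod_(j <- ys) (K x j / K y0 j) * \prod_(j <- ys | j != y) (K y0 j / K y j))); last by ring.
by rewrite eqj invrN; field; rewrite Ky0.
Qed.

(** The interpolation weights depend on [x] and the nodes only, so they are common to all products
    of the sum. *)
Lemma interpolation_vanish (I : Type) (r : seq I) (P : pred I) (A : I -> F) (us : I -> seq U)
    (M : nat) (nodes : seq T) (x : T) :
  (forall i, P i -> size (us i) = M) -> (forall i, P i -> all E (us i)) ->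
  size nodes = M.+1 -> uniq nodes -> all D nodes -> D x ->
  {in nodes &, forall y y', y != y' -> K y y' != 0} ->
  {in nodes, forall y, \sum_(i <- r | P i) A i * \prod_(u <- us i) H u y = 0} ->
  \sum_(i <- r | P i) A i * \prod_(u <- us i) H u x = 0.
Proof.
move=> szus Eus szn un Dn Dx Kn f0.
transitivity (\sum_(i <- r | P i) \sum_(y <- nodes) (\prod_(j <- nodes | j != y) (K x j / K y j)) *
    (A i * \prod_(u <- us i) H u y)).
  apply: eq_bigr => i Pi; rewrite (lagrange (nodes := nodes)) ?szus ?Eus //.
  by rewrite mulr_sumr; apply: eq_bigr => y _; ring.
rewrite exchange_big /= big_seq big1 // => y hy.
by rewrite -mulr_sumr f0 // mulr0.
Qed.
End Interpolation.

(** * The shift produced by an interpolation node *)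

Section Pochhammer.
Variables (F : fieldType) (th : F -> F) (q : F).
Hypothesis q0 : q != 0.
Hypothesis thV : forall x : F, x != 0 -> th x^-1 = - th x / x.

Definition poch (a : F) (k : nat) : F := \prod_(0 <= i < k) th (a * q ^+ i).

Lemma poch0 a : poch a 0 = 1. Proof. by rewrite /poch big_geq. Qed.

Lemma pochSr a k : poch a k.+1 = poch a k * th (a * q ^+ k).
Proof. by rewrite /poch big_nat_recr. Qed.

Lemma pochD a i j : poch a (i + j) = poch a i * poch (a * q ^+ i) j.
Proof.
elim: j => [|j IH]; first by rewrite addn0 poch0 mulr1.
by rewrite addnS !pochSr IH exprD -!mulrA.
Qed.

Lemma pochS a k : poch a k.+1 = th a * poch (a * q) k.
Proof. by rewrite -addn1 addnC pochD expr1 pochSr poch0 mul1r expr0 mulr1. Qed.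

(** This is (-1)^s q^(C(s,2)), the constant produced when a Pochhammer symbol is reversed. *)
Definition nv (s : nat) : F := \prod_(0 <= i < s) - q ^+ i.

Lemma nv_neq0 s : nv s != 0.
Proof.
rewrite /nv; elim: s => [|s IH]; first by rewrite big_geq ?oner_eq0.
by rewrite big_nat_recr //= mulf_neq0 // oppr_eq0 expf_neq0.
Qed.

Lemma nv_sqr s : q ^+ s * nv s ^+ 2 = (q ^+ s) ^+ s.
Proof.
elim: s => [|s IH]; first by rewrite /nv big_geq // expr1n !mulr1.
rewrite /nv big_nat_recr //= -/(nv s) exprMn sqrrN exprS.
transitivity (q * q ^+ s ^+ 2 * (q ^+ s * nv s ^+ 2)); first by ring.
by rewrite IH -!exprS -!exprM -exprS -!exprD; congr (q ^+ _); lia.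
Qed.

(** The factors are taken in reverse order and each argument is inverted by [thV]. *)
Lemma poch_inv x s : x != 0 -> poch x s = x ^+ s * nv s * poch (q / (q ^+ s * x)) s.
Proof.
move=> x0; rewrite /poch /nv [X in _ = _ * X]big_nat_rev add0n /=.
have -> : x ^+ s = \prod_(0 <= i < s) x by rewrite prodr_const_nat subn0.
rewrite -!big_split /=.
rewrite !big_nat; apply: eq_bigr => i /andP[_ lis].
have X0 : (x * q ^+ i)^-1 != 0 by rewrite invr_eq0 mulf_neq0 // expf_neq0.
have -> : q / (q ^+ s * x) * q ^+ (s - i.+1) = (x * q ^+ i)^-1.
  have -> : q ^+ s = q * q ^+ i * q ^+ (s - i.+1) by rewrite -exprS -exprD; congr (q ^+ _); lia.
  have: q ^+ i != 0 by rewrite expf_neq0.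
  have: q ^+ (s - i.+1) != 0 by rewrite expf_neq0.
  move: (q ^+ i) (q ^+ (s - i.+1)) => A B A0 B0.
  by field; rewrite x0 q0 A0 B0.
rewrite thV; last by rewrite mulf_neq0 // expf_neq0.
have: q ^+ i != 0 by rewrite expf_neq0.
by move: (q ^+ i) => A A0; field; rewrite x0 A0.
Qed.

(** Split [poch (x / q ^+ m) (s + m)] once after [s] and once after [m] factors, and reverse the
    piece of length [m] in both splittings. *)
Lemma poch_exchange x s m : x != 0 ->
  poch (x / q ^+ m) s * (q ^+ s) ^+ m * poch (q / (q ^+ s * x)) m = poch (q / x) m * poch x s.
Proof.
move=> x0; have qm0 : q ^+ m != 0 by rewrite expf_neq0.
have qs0 : q ^+ s != 0 by rewrite expf_neq0.
have y0 : x / q ^+ m != 0 by rewrite mulf_neq0 // invr_eq0.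
have E := pochD (x / q ^+ m) s m.
rewrite addnC pochD (@poch_inv _ m y0) divfK // in E.
have y1 : x / q ^+ m * q ^+ s != 0 by rewrite mulf_neq0.
rewrite (@poch_inv _ m y1) in E.
have e1 : q / (q ^+ m * (x / q ^+ m)) = q / x by move: (q ^+ m) qm0 => A A0; field; rewrite A0 x0.
have e2 : q / (q ^+ m * (x / q ^+ m * q ^+ s)) = q / (q ^+ s * x).
  by move: (q ^+ m) qm0 (q ^+ s) qs0 => A A0 B B0; field; rewrite A0 x0 B0.
rewrite e1 e2 [in RHS]exprMn in E.
apply: (@mulfI _ ((x / q ^+ m) ^+ m * nv m)); first by rewrite mulf_neq0 ?expf_neq0 ?nv_neq0.
by rewrite !mulrA in E *; rewrite E; ring.
Qed.

Lemma poch_step x s : th x * poch (x * q) s = poch x s * th (x * q ^+ s).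
Proof. by rewrite -pochS pochSr. Qed.

Definition single n (o : 'I_n) (s : nat) (k : 'I_n) : nat := if k == o then s else 0%N.

Section Node.
Variable n : nat.
Implicit Types (m y : 'I_n -> nat) (z : 'I_n -> F).

Definition vdm z : F := \prod_(j < n) \prod_(k < n | (j < k)%N) (z j * th (z k / z j)).

Definition qshift z y : 'I_n -> F := fun k => z k * q ^+ y k.

(* The summand times [\prod_k (a q z_k / b, a q z_k / c)_(m_k)], so that [b] and [c]
   no longer occur in a denominator. *)
Definition cleared_term (a b c d e : F) z m y : F :=
  let w := (\sum_(k < n) y k)%N in
  vdm (qshift z y) / vdm z
  * (\prod_(k < n) (th (a * z k * q ^+ (y k + w)) / th (a * z k)))
  * (poch b w * poch c w
     * \prod_(j < n) (poch (a * z j) w / poch (a * q ^+ (1 + m j) * z j) w))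
  * (poch (a * q / d) w * poch (a * q / e) w)^-1
  * q ^+ w
  * (\prod_(k < n) (poch (d * z k) (y k) * poch (e * z k) (y k)))
  * (\prod_(k < n) poch (a * q * z k / b * q ^+ y k) (m k - y k))
  * (\prod_(j < n) \prod_(k < n) poch (q ^- m j * z k / z j) (y k))
  * ((\prod_(k < n) poch (a * q * z k / c * q ^+ y k) (m k - y k))
     / \prod_(j < n) \prod_(k < n) poch (q * z k / z j) (y k)).

(** The right-hand side, multiplied by the same product as [cleared_term]. *)
Definition cleared_rhs (a b c d : F) z m : F :=
  let M := (\sum_(k < n) m k)%N in
  poch (a * q / (c * d)) M * poch (a * q / (b * d)) M
  / (poch (a * q / d) M * poch (a * q / (b * c * d)) M)
  * \prod_(k < n) (poch (a * q * z k) (m k) * poch (a * q * z k / (b * c)) (m k)).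

Variables (o : 'I_n) (s : nat).
Local Notation dl := (single o s).

Lemma sum_dl : (\sum_(k < n) dl k = s)%N.
Proof.
rewrite (bigD1 o) //= /single eqxx big1 ?addn0 // => i /negbTE ->; by [].
Qed.

Lemma prod_dl (f : 'I_n -> nat -> F) : (forall k, f k 0%N = 1) ->
  \prod_(k < n) f k (dl k) = f o s.
Proof.
move=> f0; rewrite (bigD1 o) //= /single eqxx big1 ?mulr1 // => i /negbTE ->; exact: f0.
Qed.

(** Only pairs containing [o] change. If [o] is the smaller index, [tV] first turns z_o
    theta(z_k/z_o) into - z_k theta(z_o/z_k), so that both kinds of pairs contribute the same
    ratio. *)
Lemma vdm_qshift z : (forall k, z k != 0) -> vdm z != 0 ->
  vdm (qshift z dl) = vdm z * \prod_(j < n | j != o) (th (z o * q ^+ s / z j) / th (z o / z j)).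
Proof.
move=> z0 vz.
set r := fun j => th (z o * q ^+ s / z j) / th (z o / z j).
have tz (j k : 'I_n) : (j < k)%N -> th (z k / z j) != 0.
  move=> jk; apply: contraNneq vz => E; rewrite /vdm (bigD1 j) //= (bigD1 k) //= E.
  by rewrite mulr0 !mul0r.
have tV (x y : F) : x != 0 -> y != 0 -> x * th (y / x) = - y * th (x / y).
  move=> x0 y0; rewrite -[y / x]invrK thV ?invr_eq0 ?mulf_neq0 ?invr_eq0 //.
  rewrite invf_div invf_div; by field; rewrite ?x0 ?y0.
(* The two conditionals attach the ratio to whichever index of the pair is [o], so that the double
   product splits. *)
transitivity (\prod_(j < n) \prod_(k < n | (j < k)%N)
   (z j * th (z k / z j) * ((if k == o then r j else 1) * (if j == o then r k else 1)))).
  apply: eq_bigr => j _; apply: eq_bigr => k jk.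
  rewrite /qshift /single; case: (eqVneq k o) => [ko|ko]; case: (eqVneq j o) => [jo|jo].
  - by move: jk; rewrite ko jo ltnn.
  - rewrite ko in jk *; rewrite expr0 !mulr1 /r.
    by field; rewrite tz.
  - rewrite jo in jk *; rewrite expr0 !mulr1 mul1r /r.
    have qs0 : q ^+ s != 0 by rewrite expf_neq0.
    rewrite tV // ?mulf_neq0 // [X in _ = X * _]tV //.
    have tt : th (z o / z k) != 0.
      apply: contraNneq (tz _ _ jk) => E; have := tV _ _ (z0 o) (z0 k).
      by rewrite E mulr0 => /eqP; rewrite mulf_eq0 (negbTE (z0 o)).
    by field.
  - by rewrite expr0 !mulr1.
under eq_bigr do rewrite big_split /=.
rewrite big_split /= -/(vdm z); congr (_ * _).
under eq_bigr do rewrite big_split /=.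
rewrite big_split /=.
rewrite (exchange_big_dep predT) //= (bigD1 o) //= eqxx.
rewrite [X in _ * X * _]big1 ?mulr1; last first.
  by move=> i /negbTE io; rewrite big1 // => j _; rewrite io.
rewrite [X in _ * X](bigD1 o) //= eqxx.
rewrite [X in _ * (_ * X)]big1 ?mulr1; last first.
  by move=> i /negbTE io; rewrite big1 // => j _; rewrite io.
rewrite [RHS](bigID (fun j : 'I_n => (j < o)%N)) /=.
congr (_ * _); apply: eq_bigl => j.
  by case: eqVneq => // ->; rewrite ltnn.
by rewrite -leqNgt ltn_neqAle eq_sym.
Qed.

Section Reduction.
Variables (a b c d e : F) (z : 'I_n -> F) (m' : 'I_n -> nat).
Hypotheses (a0 : a != 0) (b0 : b != 0) (c0 : c != 0) (d0 : d != 0) (e0 : e != 0).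
Hypothesis z0 : forall k, z k != 0.
Let z' := qshift z dl.
Let m k := (m' k + dl k)%N.
Hypothesis vz : vdm z != 0.
Hypothesis vz' : vdm z' != 0.
Hypothesis cE : c = a * q ^+ s * z o.
Hypothesis hz : forall k, poch (q * z k / z o) (m k) != 0.
Hypothesis hz' : forall k, poch (q * z' k / z' o) (m' k) != 0.
Hypothesis haz : forall k, th (a * z k) != 0.
Hypothesis haz' : forall k, th (a * q ^+ s * z' k) != 0.

(* Up to this factor, the terms with [s <= y o] at [c = a * q ^+ s * z o] are those
   of the identity for [m'], [z'], [a * q ^+ s] and [b * q ^+ s]; the factor
   [(a * z' o)_w] of the latter comes from [(c)_w] and its [(c)_w] from
   [(a * z o)_w]. *)
Definition shift_coef : F :=
  vdm z' / vdm z
  * (\prod_(k < n) (th (a * q ^+ s * z' k) / th (a * z k)))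
  * (poch b s * poch c s * \prod_(j < n) (poch (a * z j) s / poch (a * q ^+ (1 + m j) * z j) s))
  * (poch (a * q / d) s * poch (a * q / e) s)^-1
  * q ^+ s
  * (poch (d * z o) s * poch (e * z o) s)
  * \prod_(j < n) poch (q ^- m j * z o / z j) s
  * (\prod_(k < n) (poch (q * z' k / z' o) (m' k) / poch (q * z k / z o) (m k))
     / \prod_(j < n | j != o) poch (q * z o / z j) s).

(** Symbols of length [w] are split after [s] factors, those of length [y k] after [dl k]; the
    initial pieces are free of [y'] and enter [shift_coef]. *)
Lemma cleared_term_shift (y' : 'I_n -> nat) : (forall k, (y' k <= m' k)%N) ->
  cleared_term a b c d e z m (fun k => (y' k + dl k)%N) =
  shift_coef * cleared_term (a * q ^+ s) (b * q ^+ s) c d e z' m' y'.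
Proof.
move=> ley; rewrite /cleared_term /shift_coef.
set w := (\sum_(k < n) (y' k + dl k))%N.
set w' := (\sum_(k < n) y' k)%N.
have wE : w = (s + w')%N by rewrite /w big_split /= sum_dl addnC.
have z'0 k : z' k != 0 by rewrite mulf_neq0 // expf_neq0.
have zqq k : qshift z (fun k => (y' k + dl k)%N) k = qshift z' y' k.
  by rewrite /qshift /z' /qshift addnC exprD mulrA.
have -> : vdm (qshift z (fun k => (y' k + dl k)%N)) = vdm (qshift z' y').
  by rewrite /vdm; apply: eq_bigr => j _; apply: eq_bigr => k _; rewrite !zqq.
have E2 : \prod_(k < n) (th (a * z k * q ^+ (y' k + dl k + w)) / th (a * z k)) =
  \prod_(k < n) (th (a * q ^+ s * z' k) / th (a * z k)) *
  \prod_(k < n) (th (a * q ^+ s * z' k * q ^+ (y' k + w')) / th (a * q ^+ s * z' k)).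
  rewrite -big_split; apply: eq_bigr => k _ /=.
  have -> : a * z k * q ^+ (y' k + dl k + w) = a * q ^+ s * z' k * q ^+ (y' k + w').
    by rewrite wE /z' /qshift; field_pow q q0.
  field; by rewrite haz haz'.
have E3 : poch b w * poch c w * \prod_(j < n) (poch (a * z j) w / poch (a * q ^+ (1 + m j) * z j) w) =
  poch b s * poch c s * \prod_(j < n) (poch (a * z j) s / poch (a * q ^+ (1 + m j) * z j) s) *
  (poch (b * q ^+ s) w' * poch c w' * \prod_(j < n)
     (poch (a * q ^+ s * z' j) w' / poch (a * q ^+ s * q ^+ (1 + m' j) * z' j) w')).
  rewrite wE !pochD.
  have -> : \prod_(j < n) (poch (a * z j) (s + w') / poch (a * q ^+ (1 + m j) * z j) (s + w')) =
    \prod_(j < n) (poch (a * z j) s / poch (a * q ^+ (1 + m j) * z j) s) *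
    (\prod_(j < n) poch (a * z j * q ^+ s) w' *
     \prod_(j < n) (poch (a * q ^+ s * q ^+ (1 + m' j) * z' j) w')^-1).
    rewrite -!big_split; apply: eq_bigr => k _ /=.
    rewrite !pochD.
    have -> : a * q ^+ (1 + m k) * z k * q ^+ s = a * q ^+ s * q ^+ (1 + m' k) * z' k.
      by rewrite /z' /qshift /m; field_pow q q0.
    rewrite invfM; ring.
  rewrite [X in _ = _ * (_ * X)]big_split /=.
  have -> : \prod_(j < n) poch (a * q ^+ s * z' j) w' =
     poch (c * q ^+ s) w' * \prod_(j < n | j != o) poch (a * z j * q ^+ s) w'.
    rewrite (bigD1 o) //=; congr (_ * _).
      by congr poch; rewrite cE /z' /qshift /single eqxx; ring.
    by apply: eq_bigr => j /negbTE jo; congr poch; rewrite /z' /qshift /single jo expr0; ring.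
  rewrite [\prod_(j < n) poch (a * z j * q ^+ s) w'](bigD1 o) //=.
  have -> : a * z o * q ^+ s = c by rewrite cE; ring.
  ring.
have E5 : (poch (a * q / d) w * poch (a * q / e) w)^-1 =
   (poch (a * q / d) s * poch (a * q / e) s)^-1 *
   (poch (a * q ^+ s * q / d) w' * poch (a * q ^+ s * q / e) w')^-1.
  rewrite wE !pochD.
  have aux f : a * q / f * q ^+ s = a * q ^+ s * q / f by ring.
  by rewrite !aux !invfM; ring.
have E8 : \prod_(k < n) (poch (d * z k) (y' k + dl k) * poch (e * z k) (y' k + dl k)) =
   (poch (d * z o) s * poch (e * z o) s) *
   \prod_(k < n) (poch (d * z' k) (y' k) * poch (e * z' k) (y' k)).
  rewrite -(prod_dl (f := fun k i => poch (d * z k) i * poch (e * z k) i)); last first.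
    by move=> k; rewrite !poch0 mulr1.
  rewrite -big_split; apply: eq_bigr => k _ /=.
  by rewrite ![(y' k + _)%N]addnC !pochD /z' /qshift !mulrA; ring.
have E9 : \prod_(k < n) poch (a * q * z k / b * q ^+ (y' k + dl k)) (m k - (y' k + dl k)) =
  \prod_(k < n) poch (a * q ^+ s * q * z' k / (b * q ^+ s) * q ^+ y' k) (m' k - y' k).
  apply: eq_bigr => k _; rewrite /m subnDr; congr poch.
  by rewrite /z' /qshift; field_pow q q0.
have E10 : \prod_(j < n) \prod_(k < n) poch (q ^- m j * z k / z j) (y' k + dl k) =
  \prod_(j < n) poch (q ^- m j * z o / z j) s *
  \prod_(j < n) \prod_(k < n) poch (q ^- m' j * z' k / z' j) (y' k).
  rewrite -big_split; apply: eq_bigr => j _ /=.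
  rewrite -(prod_dl (f := fun k i => poch (q ^- m j * z k / z j) i)); last by move=> k; rewrite poch0.
  rewrite -big_split; apply: eq_bigr => k _ /=.
  rewrite addnC pochD; congr (_ * poch _ _).
  by have := z0 j; rewrite /z' /qshift /m => zj; field_pow q q0.
have E11 : (\prod_(k < n) poch (a * q * z k / c * q ^+ (y' k + dl k)) (m k - (y' k + dl k)))
     / \prod_(j < n) \prod_(k < n) poch (q * z k / z j) (y' k + dl k) =
  (\prod_(k < n) (poch (q * z' k / z' o) (m' k) / poch (q * z k / z o) (m k))
     / \prod_(j < n | j != o) poch (q * z o / z j) s) *
  ((\prod_(k < n) poch (a * q ^+ s * q * z' k / c * q ^+ y' k) (m' k - y' k))
     / \prod_(j < n) \prod_(k < n) poch (q * z' k / z' j) (y' k)).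
  have zo := z0 o.
  rewrite [\prod_(j < n) \prod_(k < n) poch (q * z k / z j) _](bigD1 o) //=.
  rewrite [\prod_(j < n) \prod_(k < n) poch (q * z' k / z' j) _](bigD1 o) //=.
  have -> : \prod_(i < n | i != o) \prod_(k < n) poch (q * z k / z i) (y' k + dl k) =
    \prod_(j < n | j != o) poch (q * z o / z j) s *
    \prod_(i < n | i != o) \prod_(k < n) poch (q * z' k / z' i) (y' k).
    rewrite -big_split; apply: eq_bigr => j /negbTE jo /=.
    rewrite -(prod_dl (f := fun k i => poch (q * z k / z j) i)); last by move=> k; rewrite poch0.
    rewrite -big_split; apply: eq_bigr => k _ /=.
    rewrite addnC pochD; congr (_ * poch _ _).
    have dj : dl j = 0%N by rewrite /single jo.
    by rewrite /z' /qshift dj; have := z0 j => zj; field_pow q q0.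
  (* A crosswise completion: at this [c], the cleared factors in [c] of the shifted identity
     complete the denominators in [q * z k / z o] of the original one, and conversely. This leaves
     symbols of the full lengths [m k] and [m' k]. *)
  have K : (\prod_(k < n) poch (a * q * z k / c * q ^+ (y' k + dl k)) (m k - (y' k + dl k))) /
      \prod_(k < n) poch (q * z k / z o) (y' k + dl k) =
    \prod_(k < n) (poch (q * z' k / z' o) (m' k) / poch (q * z k / z o) (m k)) *
    ((\prod_(k < n) poch (a * q ^+ s * q * z' k / c * q ^+ y' k) (m' k - y' k)) /
     \prod_(k < n) poch (q * z' k / z' o) (y' k)).
    rewrite -!prodfV -!big_split; apply: eq_bigr => k _ /=.
    rewrite /m subnDr.
    have h1 : poch (q * z k / z o) (y' k + dl k) * poch (a * q ^+ s * q * z' k / c * q ^+ y' k) (m' k - y' k) =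
      poch (q * z k / z o) (m k).
      have e1 : m k = (y' k + dl k + (m' k - y' k))%N by rewrite /m; move: (ley k); clear; lia.
      rewrite e1 [in RHS]pochD; congr (_ * poch _ _).
      by rewrite cE /z' /qshift; field_pow q q0.
    have h2 : poch (q * z' k / z' o) (y' k) * poch (a * q * z k / c * q ^+ (y' k + dl k)) (m' k - y' k) =
      poch (q * z' k / z' o) (m' k).
      have e1 : m' k = (y' k + (m' k - y' k))%N by move: (ley k); clear; lia.
      rewrite [in RHS]e1 [in RHS]pochD; congr (_ * poch _ _).
      have do_ : dl o = s by rewrite /single eqxx.
      by rewrite cE /z' /qshift do_; field_pow q q0.
    have := hz' k; have := hz k; rewrite -h1 -h2 !mulf_eq0 !negb_or => /andP[n1 n2] /andP[n3 n4].
    by field; rewrite n1 n2 n3.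
  have aux (A B A' B' D t u : F) : A / B = t * (A' / B') ->
      A / (B * (u * D)) = t / u * (A' / (B' * D)).
    by move=> AB; rewrite !invfM [LHS]mulrA AB; ring.
  exact: aux K.
rewrite E2 E3 E5 E8 E9 E10 E11 wE exprD.
have -> : vdm (qshift z' y') / vdm z = vdm z' / vdm z * (vdm (qshift z' y') / vdm z').
  by field; rewrite vz vz'.
ring.
Qed.

Hypothesis ht : forall j, j != o -> th (z o / z j) != 0.
Hypothesis hzo : forall j, j != o -> poch (q * z o / z j) s != 0.
Hypothesis hm : forall j, poch (a * q ^+ (1 + m j) * z j) s != 0.

Let z'0 k : z' k != 0. Proof. by rewrite mulf_neq0 // expf_neq0. Qed.

(** The part of [shift_coef] that involves quotients of the [z k] alone reduces to a sign and a
    power of [q], one index [j] at a time: by reversal for [j = o], by [poch_exchange] and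
    [poch_step] at z_o/z_j otherwise. *)
Lemma shift_coef_z :
  vdm z' / vdm z * \prod_(j < n) poch (q ^- m j * z o / z j) s
  * (\prod_(k < n) (poch (q * z' k / z' o) (m' k) / poch (q * z k / z o) (m k))
     / \prod_(j < n | j != o) poch (q * z o / z j) s)
  = nv s / (q ^+ s) ^+ (\sum_(k < n) m k).
Proof.
have zo := z0 o.
rewrite vdm_qshift // -prodrXr.
rewrite [X in _ / _ * X](bigD1 o) //= [X in _ * (X / _)](bigD1 o) //=.
rewrite [X in nv s / X](bigD1 o) //=.
have Eo : poch (q ^- m o * z o / z o) s * (poch (q * z' o / z' o) (m' o) / poch (q * z o / z o) (m o))
    = nv s / (q ^+ s) ^+ m o.
  have mo : m o = (m' o + s)%N by rewrite /m /single eqxx.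
  have qmo : q ^- m o != 0 by rewrite invr_neq0 // expf_neq0.
  have := hz o; rewrite !mulfK ?z'0 // => hpc.
  rewrite poch_inv // exprVn -!exprM [(s * m o)%N]mulnC.
  have eo : poch q (m o) = poch q (m' o) * poch (q / (q ^+ s / q ^+ m o)) s.
    by rewrite mo pochD; congr (_ * poch _ _); field_pow q q0.
  move: hpc; rewrite eo mulf_eq0 negb_or => /andP[h1 h2].
  have : q ^+ (m o * s) != 0 by rewrite expf_neq0.
  move: (q ^+ (m o * s)) => Q hQ; field.
  by rewrite h1 h2 hQ.
have Ej : \prod_(j < n | j != o) (th (z o * q ^+ s / z j) / th (z o / z j)) *
   \prod_(j < n | j != o) poch (q ^- m j * z o / z j) s *
   \prod_(j < n | j != o) (poch (q * z' j / z' o) (m' j) / poch (q * z j / z o) (m j)) /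
   \prod_(j < n | j != o) poch (q * z o / z j) s
   = (\prod_(j < n | j != o) ((q ^+ s) ^+ m j))^-1.
  rewrite -!prodfV -!big_split; apply: eq_bigr => j jo /=.
  have dj : dl j = 0%N by rewrite /single (negbTE jo).
  have zj := z0 j.
  have x0 : z o / z j != 0 by rewrite mulf_neq0 // invr_neq0.
  have h1 := poch_exchange s (m j) x0; have h2 := poch_step (z o / z j) s.
  have mj : m' j = m j by rewrite /m dj addn0.
  rewrite mj.
  have e1 : q ^- m j * z o / z j = z o / z j / q ^+ m j by field_pow q q0.
  have e2 : q * z' j / z' o = q / (q ^+ s * (z o / z j)).
    have do_ : dl o = s by rewrite /single eqxx.
    by rewrite /z' /qshift dj do_; field_pow q q0.
  have e3 : q * z j / z o = q / (z o / z j) by field_pow q q0.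
  have e4 : q * z o / z j = z o / z j * q by ring.
  have e5 : z o * q ^+ s / z j = z o / z j * q ^+ s by ring.
  have := hz j; have := hzo jo; have := ht jo; rewrite e1 e2 e3 e4 e5 => n1 n2 n3.
  have n4 : (q ^+ s) ^+ m j != 0 by rewrite !expf_neq0.
  have n5 : poch (z o / z j) s != 0.
    have := mulf_neq0 n1 n2; rewrite h2 mulf_eq0 negb_or => /andP[] //.
  apply: (mulfI n4); rewrite mulfV //.
  have fin (t t' p p' u v w Q : F) : p * Q * v = u * p' -> t * w = p' * t' ->
      t != 0 -> w != 0 -> u != 0 -> Q * (t' / t * p * (v / u) / w) = 1.
    move=> E1 E2 n1' n2' n3'.
    transitivity (p * Q * v * t' / (t * u * w)); first by field; rewrite n1' n2' n3'.
    rewrite E1; transitivity (p' * t' / (t * w)); first by field; rewrite n1' n2' n3'.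
    by rewrite -E2 divff // mulf_neq0.
  exact: fin h1 h2 n1 n2 n3.
rewrite [in RHS]invfM -Ej [RHS]mulrA -Eo.
field; rewrite vz hz !andbT.
by apply/prodf_neq0 => j jo; exact: hzo.
Qed.

Let M := (\sum_(k < n) m k)%N.
Let M' := (\sum_(k < n) m' k)%N.
Hypothesis bal : a ^+ 2 * q ^+ (1 + M) = b * c * d * e.

Let M_E : M = (M' + s)%N. Proof. by rewrite /M big_split /= sum_dl. Qed.

Lemma cleared_rhs_shift : cleared_rhs a b c d z m = shift_coef * cleared_rhs (a * q ^+ s) (b * q ^+ s) c d z' m'.
Proof.
have zo := z0 o.
have qs0 : q ^+ s != 0 by rewrite expf_neq0.
(* As [c = a * z o * q ^+ s], the symbol [poch c s] is the extra piece at [k = o], and the equality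
   holds factor by factor. *)
have E6 : \prod_(k < n) (th (a * q ^+ s * z' k) / th (a * z k)) *
   (poch c s * \prod_(j < n) (poch (a * z j) s / poch (a * q ^+ (1 + m j) * z j) s)) *
   \prod_(k < n) poch (a * q ^+ s * q * z' k) (m' k) = \prod_(k < n) poch (a * q * z k) (m k).
  have -> : c = a * z o * q ^+ s by rewrite cE; ring.
  rewrite -(prod_dl (f := fun k i => poch (a * z k * q ^+ s) i)); last by move=> k; rewrite poch0.
  rewrite -!big_split; apply: eq_bigr => k _ /=.
  have h1 : poch (a * q * z k) (m k) * poch (a * q ^+ (1 + m k) * z k) s =
     poch (a * z k * q) (s + dl k) * poch (a * q ^+ s * q * z' k) (m' k).
    have -> : a * q ^+ (1 + m k) * z k = a * q * z k * q ^+ m k by field_pow q q0.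
    rewrite -pochD; have -> : (m k + s = s + dl k + m' k)%N by rewrite /m; clear; lia.
    by rewrite pochD /z' /qshift; congr (poch _ _ * poch _ _); field_pow q q0.
  have h2 := poch_step (a * z k) (s + dl k).
  rewrite [X in _ = X * _]pochD in h2.
  have e1 : a * z k * q ^+ (s + dl k) = a * q ^+ s * z' k by rewrite /z' /qshift; field_pow q q0.
  rewrite e1 in h2.
  apply: (mulIf (hm k)); rewrite h1; apply: (mulfI (haz k)); rewrite [RHS]mulrA h2.
  by field; rewrite haz hm.
have E5 : \prod_(k < n) poch (a * q * z k / (b * c)) (m k) =
  poch (q / (q ^+ s * b)) s * \prod_(k < n) poch (a * q ^+ s * q * z' k / (b * q ^+ s * c)) (m' k).
  have -> : q / (q ^+ s * b) = a * q * z o / (b * c) * q ^+ 0 by rewrite cE; field_pow q q0.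
  rewrite expr0 mulr1.
  rewrite -(prod_dl (f := fun k i => poch (a * q * z k / (b * c)) i)); last by move=> k; rewrite poch0.
  rewrite -big_split; apply: eq_bigr => k _ /=.
  by rewrite /m addnC pochD /z' /qshift; congr (_ * poch _ _); field_pow q q0.
have E1 : poch (a * q / d) M = poch (a * q / d) s * poch (a * q ^+ s * q / d) M'.
  by rewrite M_E addnC pochD; congr (_ * poch _ _); field_pow q q0.
(* Here and in [E4] the last [s] factors are split off; the balancing condition identifies their
   base with [e * z o], respectively with the base of the reversed [poch (a * q / e) s]. *)
have E2 : poch (a * q / (b * d)) M = poch (a * q ^+ s * q / (b * q ^+ s * d)) M' * poch (e * z o) s.
  rewrite M_E pochD; congr (poch _ _ * poch _ _); first by field_pow q q0.
  apply: (mulfI a0); apply: (mulIf qs0).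
  transitivity (a ^+ 2 * q ^+ (1 + M) / (b * d)); first by rewrite M_E; field_pow q q0.
  by rewrite bal cE; field_pow q q0.
have E3 : poch (a * q / (c * d)) M = poch (q / (q ^+ s * (d * z o))) s * poch (a * q ^+ s * q / (c * d)) M'.
  rewrite M_E addnC pochD; congr (poch _ _ * poch _ _); first by rewrite cE; field_pow q q0.
  by field_pow q q0.
have E4 : poch (a * q / (b * c * d)) M =
    poch (a * q ^+ s * q / (b * q ^+ s * c * d)) M' * poch (q / (q ^+ s * (a * q / e))) s.
  rewrite M_E pochD; congr (poch _ _ * poch _ _); first by field_pow q q0.
  apply: (mulfI a0); apply: (mulIf qs0).
  transitivity (a ^+ 2 * q ^+ (1 + M) / (b * c * d)); first by rewrite M_E; field_pow q q0.
  by rewrite bal; field_pow q q0.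
have K := shift_coef_z.
rewrite /cleared_rhs -/M -/M' E1 E2 E3 E4 !big_split /= E5 -E6.
have -> : shift_coef = \prod_(k < n) (th (a * q ^+ s * z' k) / th (a * z k)) *
   (poch c s * \prod_(j < n) (poch (a * z j) s / poch (a * q ^+ (1 + m j) * z j) s)) *
   (poch b s * (poch (a * q / d) s * poch (a * q / e) s)^-1 * q ^+ s
    * (poch (d * z o) s * poch (e * z o) s) * (nv s / (q ^+ s) ^+ M)).
  by rewrite -K /shift_coef; ring.
have d1 : d * z o != 0 by rewrite mulf_neq0.
have e1 : a * q / e != 0 by rewrite !mulf_neq0 ?invr_neq0.
rewrite (poch_inv s b0) (poch_inv s d1) (poch_inv s e1).
(* The elementary factors of the three reversals and of [shift_coef_z] combine, by [nv_sqr], to the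
   s-th power of bcde / (a^2 q^(1+M)). *)
have pw : b ^+ s * nv s * (d * z o) ^+ s * nv s * nv s * q ^+ s / ((a * q / e) ^+ s * nv s * (q ^+ s) ^+ M) = 1.
  have nv0 := nv_neq0 s.
  have qM : (q ^+ s) ^+ M != 0 by rewrite !expf_neq0.
  have es : (a * q / e) ^+ s != 0 by rewrite expf_neq0.
  transitivity (b ^+ s * (d * z o) ^+ s * (q ^+ s * nv s ^+ 2) / ((a * q / e) ^+ s * (q ^+ s) ^+ M)).
    by field; rewrite nv0 qM es.
  rewrite nv_sqr -exprAC -!exprMn -exprVn -exprMn.
  have -> : b * (d * z o) * q ^+ s / (a * q / e * q ^+ M) = 1.
    transitivity (b * c * d * e / (a ^+ 2 * q ^+ (1 + M))); first by rewrite cE; field_pow q q0.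
    by rewrite -bal divff // mulf_neq0 ?expf_neq0.
  by rewrite expr1n.
rewrite -[LHS]mulr1 -pw.
move: (poch (q / (q ^+ s * b)) s) (poch (q / (q ^+ s * (d * z o))) s) => t1 t2.
move: (poch (q / (q ^+ s * (a * q / e))) s) ((a * q / e) ^+ s) => t3 t4.
rewrite !invfM; ring.
Qed.

End Reduction.
End Node.
End Pochhammer.

(** * The identity for generic parameters *)

Section Main.
Variables (F : fieldType) (th : F -> F) (q : F).
Hypothesis q0 : q != 0.
Hypothesis thV : forall x : F, x != 0 -> th x^-1 = - th x / x.
Hypothesis th1 : th 1 = 0.
Let phi (l u x : F) := th (u * x) * th (u * l / x).
Let ker (l x y : F) := th (x / y) * th (x * y / l) / x.
(* For fixed [l] the functions [phi l u] span a plane, on which [ker l x y] is, up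
   to normalization, the value at [x] of the function vanishing at [y]. *)
Hypothesis three_term : forall l u x y v : F, l != 0 -> u != 0 -> x != 0 -> y != 0 -> v != 0 ->
  phi l u x * ker l y v = phi l u y * ker l x v - phi l u v * ker l x y.

Local Notation pc := (poch th q).

Lemma thV_neq0 x : x != 0 -> th x != 0 -> th x^-1 != 0.
Proof. by move=> x0 tx; rewrite thV // mulf_neq0 ?invr_neq0 // oppr_eq0. Qed.

Lemma ker_anti l x y : x != 0 -> y != 0 -> ker l x y = - ker l y x.
Proof.
move=> x0 y0; rewrite /ker -[y / x]invrK thV ?invr_eq0 ?mulf_neq0 ?invr_eq0 //.
by rewrite !invf_div [y * x]mulrC; field; rewrite x0 y0.
Qed.

Lemma poch_neq0 x k : (forall i, (i < k)%N -> th (x * q ^+ i) != 0) -> pc x k != 0.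
Proof.
by move=> h; rewrite /poch prodf_seq_neq0; apply/allP => i; rewrite mem_index_iota => /h.
Qed.

Lemma poch_eq0 x k i : (i < k)%N -> x * q ^+ i = 1 -> pc x k = 0.
Proof.
by move=> ik xi; rewrite -(subnKC ik) pochD pochSr xi th1 mulr0 mul0r.
Qed.

Section Induction.
Variables (n N : nat).
Implicit Types (z : 'I_n -> F) (m : 'I_n -> nat).

(** With [N] fixed, the induction lowers [m] without changing the type of the summation index. *)
Definition below m (y : {ffun 'I_n -> 'I_N}) := [forall k, (y k <= m k)%N].

Definition cleared_sum a b c d e z m : F :=
  \sum_(y : {ffun 'I_n -> 'I_N} | below m y) cleared_term th q a b c d e z m (fun k => y k : nat).

(** Distinctness, as seen by [th], of all points q^i z_l with i <= m_l. It implies that the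
    Vandermonde product and the symbols in [q * z k / z j] do not vanish, and it is inherited by the
    shifted data. *)
Definition separated z m := forall l j i i', (i <= m l)%N -> (i' <= m j)%N ->
  (l, i) != (j, i') -> th (q ^+ i * z l / (q ^+ i' * z j)) != 0.

(** Terms with [y o < s] contain a factor [th 1]; in the others [s] is subtracted from [y o]. *)
Lemma cleared_sum_shift a b c d e z m' o s :
  (forall k, (m' k + single o s k < N)%N) ->
  c = a * q ^+ s * z o ->
  (forall y' : 'I_n -> nat, (forall k, (y' k <= m' k)%N) ->
   cleared_term th q a b c d e z (fun k => (m' k + single o s k)%N) (fun k => (y' k + single o s k)%N) =
   shift_coef th q o s a b c d e z m' * cleared_term th q (a * q ^+ s) (b * q ^+ s) c d e (qshift q z (single o s)) m' y') ->
  a != 0 -> z o != 0 ->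
  cleared_sum a b c d e z (fun k => (m' k + single o s k)%N) =
  shift_coef th q o s a b c d e z m' * cleared_sum (a * q ^+ s) (b * q ^+ s) c d e (qshift q z (single o s)) m'.
Proof.
move=> mN cE tE a0 zo.
rewrite /cleared_sum (bigID (fun y : {ffun 'I_n -> 'I_N} => (s <= y o)%N)) /= addrC big1; last first.
  move=> y /andP[/forallP ym]; rewrite -ltnNge => ys.
  have ymo := ym o; rewrite /single eqxx in ymo.
  have p0 : pc (a * q * z o / c * q ^+ y o) (m' o + s - y o) = 0.
    (* At this index the argument is a q^s z_o / c = 1. *)
    apply: (@poch_eq0 _ _ (s - (y o).+1)%N); first by lia.
    have -> : c = a * (q ^+ (y o) * q * q ^+ (s - (y o).+1)) * z o.
      by rewrite cE -exprSr -exprD; congr (_ * q ^+ _ * _); lia.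
    by field_pow q q0.
  by rewrite /cleared_term [X in _ * (X / _)](bigD1 o) //= /single eqxx p0 !mul0r mulr0.
rewrite add0r big_distrr /=.
(* [insubd] falls back on [y k] out of range; [lt] below shows that this never happens for the [y]
   that are kept. *)
pose up (y : {ffun 'I_n -> 'I_N}) : {ffun 'I_n -> 'I_N} :=
  [ffun k => insubd (y k) (y k + single o s k)%N].
pose dn (y : {ffun 'I_n -> 'I_N}) : {ffun 'I_n -> 'I_N} :=
  [ffun k => insubd (y k) (y k - single o s k)%N].
have dnE (y : {ffun 'I_n -> 'I_N}) k : dn y k = (y k - single o s k)%N :> nat.
  by rewrite ffunE val_insubd; case: ifP => //; have := ltn_ord (y k); lia.
have upE (y : {ffun 'I_n -> 'I_N}) k : (y k + single o s k < N)%N -> up y k = (y k + single o s k)%N :> nat.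
  by move=> h; rewrite ffunE val_insubd h.
rewrite (reindex_onto up dn) /=; last first.
  move=> y /andP[/forallP ym sy]; apply/ffunP => k; apply: val_inj.
  have e1 : (y k - single o s k + single o s k = y k)%N.
    by rewrite subnK // /single; case: eqP => // ->.
  by rewrite /= upE dnE e1.
apply: eq_big => [y|y].
  apply/andP/forallP => [[/andP[/forallP ym _] /eqP dy] k|ym].
    have := ym k; have := congr1 (fun f : {ffun 'I_n -> 'I_N} => nat_of_ord (f k)) dy.
    rewrite /= dnE; have := ltn_ord (y k); rewrite ffunE val_insubd.
    by case: ifP; lia.
  have lt k : (y k + single o s k < N)%N by have := ym k; have := mN k; lia.
  split; last by apply/eqP/ffunP => k; apply: val_inj; rewrite /= dnE upE // addnK.
  apply/andP; split; last by rewrite upE // /single eqxx leq_addl.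
  by apply/forallP => k; rewrite upE // leq_add2r.
move=> /andP[/andP[/forallP ym _] /eqP dy].
have lt k : (y k + single o s k < N)%N.
  have := ym k; have := congr1 (fun f : {ffun 'I_n -> 'I_N} => nat_of_ord (f k)) dy; have := mN k.
  rewrite /= dnE; have := ltn_ord (y k); rewrite ffunE val_insubd.
  by case: ifP; lia.
rewrite -tE; last by move=> k; have := ym k; rewrite upE // leq_add2r.
by congr cleared_term; apply: funext => k; rewrite upE.
Qed.

Definition zpos (z : 'I_n -> F) := forall k, z k != 0.

(* Makes the interpolation nodes pairwise distinct.  The bound [3 * M] leaves room
   for the shifts: replacing [M] by [M - s] shifts the exponents by at most [3 * s]. *)
Definition generic (a l : F) z m := let M := (\sum_(k < n) m k)%N in
  [/\ forall k i, (i <= 3 * M)%N -> th (a * z k * q ^+ i) != 0,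
      forall k i, (i <= 3 * M)%N -> th (a * z k * q ^+ i / l) != 0 &
      forall k j i, (i <= 3 * M)%N -> th (a ^+ 2 * z k * z j * q ^+ i / l) != 0].

Lemma separated_vdm z m : separated z m -> zpos z -> vdm th z != 0.
Proof.
move=> sz z0; apply/prodf_neq0 => j _; apply/prodf_neq0 => k jk.
rewrite mulf_neq0 ?z0 //.
have := sz k j 0%N 0%N isT isT; rewrite !mul1r; apply.
by rewrite xpair_eqE andbT; apply: contraTneq jk => ->; rewrite ltnn.
Qed.

Lemma separated_pc z m k j s : separated z m -> zpos z -> (s <= m k)%N -> pc (q * z k / z j) s != 0.
Proof.
move=> sz z0 sm; apply: poch_neq0 => i is_.
have := sz k j i.+1 0%N (leq_trans is_ sm) isT.
rewrite xpair_eqE andbF => /(_ isT); apply: contraNneq => <-; apply/eqP; congr th.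
by have := z0 j => zj; field_pow q q0.
Qed.

(** The points of the shifted data are among the original ones. *)
Lemma separated_shift z m m' o s : separated z m -> zpos z ->
  (forall k, m k = m' k + single o s k)%N -> separated (qshift q z (single o s)) m'.
Proof.
move=> sz z0 mE l j i i' il ij ne.
have := sz l j (i + single o s l)%N (i' + single o s j)%N.
rewrite !mE !leq_add2r => /(_ il ij).
rewrite /qshift !exprD => H.
have E (k : 'I_n) (u v : F) : u * (z k * v) = u * v * z k by ring.
rewrite !E; apply: H; rewrite xpair_eqE; apply: contra ne => /andP[/eqP -> ].
by rewrite eqn_add2r xpair_eqE eqxx.
Qed.

Lemma generic_shift a l z m m' o s : generic a l z m ->
  (forall k, m k = m' k + single o s k)%N -> l != 0 ->
  generic (a * q ^+ s) (l * q ^+ s) (qshift q z (single o s)) m'.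
Proof.
move=> [g1 g2 g3] mE l0.
have sE : (\sum_(k < n) m k = \sum_(k < n) m' k + s)%N.
  by under eq_bigr do rewrite mE; rewrite big_split /= sum_dl.
have dle k : (single o s k <= s)%N by rewrite /single; case: ifP.
rewrite /generic; move: (\sum_(k < n) m' k)%N sE => M' sE; split.
- move=> k i; rewrite /= => ile.
  have := g1 k (s + single o s k + i)%N; rewrite sE => H.
  suff -> : a * q ^+ s * qshift q z (single o s) k * q ^+ i = a * z k * q ^+ (s + single o s k + i).
    by apply: H; have := dle k; lia.
  by rewrite /qshift; field_pow q q0.
- move=> k i; rewrite /= => ile.
  have := g2 k (single o s k + i)%N; rewrite sE => H.
  suff -> : a * q ^+ s * qshift q z (single o s) k * q ^+ i / (l * q ^+ s) = a * z k * q ^+ (single o s k + i) / l.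
    by apply: H; have := dle k; lia.
  by rewrite /qshift; field_pow q q0.
- move=> k j i; rewrite /= => ile.
  have := g3 k j (s + single o s k + single o s j + i)%N; rewrite sE => H.
  suff -> : (a * q ^+ s) ^+ 2 * qshift q z (single o s) k * qshift q z (single o s) j * q ^+ i / (l * q ^+ s)
     = a ^+ 2 * z k * z j * q ^+ (s + single o s k + single o s j + i) / l.
    by apply: H; have := dle k; have := dle j; lia.
  by rewrite /qshift exprMn; field_pow q q0.
Qed.

(** [poch 1 w] contains [th 1] as soon as [w > 0]; on the right the symbols of length |m| cancel at
    [c = 1]. *)
Lemma cleared_sum_node1 a l d e z m : a != 0 -> l != 0 -> d != 0 -> zpos z -> (0 < N)%N ->
  vdm th z != 0 -> (forall k, th (a * z k) != 0) ->
  pc (a * q / d) (\sum_(k < n) m k) != 0 -> pc (a * q / (l * d)) (\sum_(k < n) m k) != 0 ->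
  cleared_sum a l 1 d e z m = cleared_rhs th q a l 1 d z m.
Proof.
move=> a0 l0 d0 z0 N0 vz ha h1 h2.
pose y0 : {ffun 'I_n -> 'I_N} := [ffun=> Ordinal N0].
have y0E k : y0 k = 0%N :> nat by rewrite ffunE.
rewrite /cleared_sum (bigD1 y0) /=; last by apply/forallP => k; rewrite y0E.
rewrite big1 ?addr0; last first.
  move=> y /andP[_ yn]; rewrite /cleared_term.
  set w := (\sum_(k < n) y k)%N.
  suff w0 : (0 < w)%N by rewrite (@poch_eq0 1 w 0%N) ?mulr1 // !(mulr0, mul0r).
  rewrite lt0n; apply: contraNneq yn => /eqP; rewrite sum_nat_eq0 => /forallP h.
  by apply/eqP/ffunP => k; apply: val_inj; rewrite /= y0E; apply/eqP; exact: h.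
have -> : (fun k => y0 k : nat) = (fun _ => 0%N) by apply: funext => k; rewrite y0E.
rewrite /cleared_term /cleared_rhs sum_nat_const muln0 !poch0.
have -> : vdm th (qshift q z (fun=> 0%N)) = vdm th z.
  by congr vdm; apply: funext => k; rewrite /qshift mulr1.
rewrite divff // [\prod_(k < n) (th _ / th _)]big1; last first.
  by move=> k _; rewrite mulr1 divff.
rewrite [\prod_(j < n) (pc _ _ / _)]big1; last by move=> k _; rewrite !poch0 divff ?oner_neq0.
rewrite [\prod_(j < n) (pc _ _ * pc _ _)]big1; last by move=> k _; rewrite !poch0 mulr1.
have P1 f : \prod_(j < n) \prod_(k < n) pc (f j k) 0 = 1.
  by apply: big1 => j _; apply: big1 => k _; rewrite poch0.
rewrite !P1 !mul1r !mulr1 !expr0 !invr1 !mulr1.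
rewrite mulfV ?mul1r; last by rewrite mulf_neq0.
rewrite -big_split /=; apply: eq_bigr => k _.
by rewrite !subn0 !mulr1 mulrC; congr (pc _ _ * _); ring.
Qed.

Definition nodes (a : F) z m : seq F :=
  1 :: [seq a * q ^+ ks.2 * z ks.1 | ks <- [seq (k, s) | k <- enum 'I_n, s <- iota 1 (m k)]].

(** The parameters [u] of the functions [phi l u] in the term [y]: |y| of them from [(b, c)_w] and
    [m k - y k] for each [k] from the cleared denominators, hence |m| in every term. *)
Definition phi_params (a l : F) z m (y : 'I_n -> nat) : seq F :=
  [seq q ^+ i | i <- iota 0 (\sum_(k < n) y k)]
  ++ [seq a * q * z k / l * q ^+ y k * q ^+ i | k <- enum 'I_n, i <- iota 0 (m k - y k)].

Definition phi_coef (a l d e : F) z m (y : 'I_n -> nat) : F :=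
  let w := (\sum_(k < n) y k)%N in
  vdm th (qshift q z y) / vdm th z
  * (\prod_(k < n) (th (a * z k * q ^+ (y k + w)) / th (a * z k)))
  * (\prod_(j < n) (pc (a * z j) w / pc (a * q ^+ (1 + m j) * z j) w))
  * (pc (a * q / d) w * pc (a * q / e) w)^-1
  * q ^+ w
  * (\prod_(k < n) (pc (d * z k) (y k) * pc (e * z k) (y k)))
  * (\prod_(j < n) \prod_(k < n) pc (q ^- m j * z k / z j) (y k))
  / \prod_(j < n) \prod_(k < n) pc (q * z k / z j) (y k).

Lemma prod_phi_iota l u x k :
  \prod_(v <- [seq u * q ^+ i | i <- iota 0 k]) phi l v x = pc (u * x) k * pc (u * l / x) k.
Proof.
rewrite big_map /poch /index_iota subn0 -big_split /=; apply: eq_bigr => i _.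
by rewrite /phi; congr (th _ * th _); ring.
Qed.

Lemma cleared_term_phi a l x d e z m y : l != 0 -> x != 0 ->
  cleared_term th q a (l / x) x d e z m y =
  phi_coef a l d e z m y * \prod_(u <- phi_params a l z m y) phi l u x.
Proof.
move=> l0 x0; rewrite /cleared_term /phi_coef /phi_params big_cat /= big_allpairs_dep big_enum /=.
have -> : [seq q ^+ i | i <- iota 0 (\sum_(k < n) y k)] =
  [seq 1 * q ^+ i | i <- iota 0 (\sum_(k < n) y k)] by apply: eq_map => i; rewrite mul1r.
rewrite prod_phi_iota !mul1r.
have -> : \prod_(i < n) \prod_(j <- iota 0 (m i - y i)) phi l (a * q * z i / l * q ^+ y i * q ^+ j) x =
  \prod_(k < n) pc (a * q * z k / (l / x) * q ^+ y k) (m k - y k) *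
  \prod_(k < n) pc (a * q * z k / x * q ^+ y k) (m k - y k).
  rewrite -big_split; apply: eq_bigr => k _ /=.
  rewrite -(big_map (fun j => a * q * z k / l * q ^+ y k * q ^+ j) predT (fun u => phi l u x)).
  by rewrite prod_phi_iota; congr (pc _ _ * pc _ _); field_pow q q0.
ring.
Qed.

(** With [b = l / x] and u = aq/(ld), the arguments aq/(bd) and aq/(cd) are [u * x] and [u * l / x]:
    the right-hand side is also a product of |m| functions [phi]. *)
Lemma cleared_rhs_phi a l x d z m : l != 0 -> x != 0 -> d != 0 ->
  let M := (\sum_(k < n) m k)%N in
  cleared_rhs th q a (l / x) x d z m =
  (pc (a * q / d) M * pc (a * q / (l * d)) M)^-1
  * \prod_(k < n) (pc (a * q * z k) (m k) * pc (a * q * z k / l) (m k))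
  * \prod_(u <- [seq a * q / (l * d) * q ^+ i | i <- iota 0 M]) phi l u x.
Proof.
move=> l0 x0 d0 M; rewrite prod_phi_iota /cleared_rhs -/M divfK //.
have -> : a * q / (x * d) = a * q / (l * d) * l / x by field_pow q q0.
have -> : a * q / (l / x * d) = a * q / (l * d) * x by field_pow q q0.
ring.
Qed.

Lemma size_phi_params a l z m y : (forall k, (y k <= m k)%N) ->
  size (phi_params a l z m y) = (\sum_(k < n) m k)%N.
Proof.
move=> ym; rewrite size_cat size_map size_iota size_allpairs_dep sumnE big_map big_enum /=.
by rewrite -big_split; apply: eq_bigr => k _ /=; rewrite size_iota subnKC.
Qed.

Lemma size_nodes a z m : size (nodes a z m) = (\sum_(k < n) m k).+1.
Proof.
rewrite /= size_map size_allpairs_dep sumnE big_map big_enum /=.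
by congr _.+1; apply: eq_bigr => k _; rewrite size_iota.
Qed.

Lemma nodesP a z m x : reflect (x = 1 \/ exists k s, [/\ (0 < s)%N, (s <= m k)%N & x = a * q ^+ s * z k])
  (x \in nodes a z m).
Proof.
rewrite inE; apply: (iffP orP) => [[/eqP ->|/mapP[[k s] /allpairsPdep[k' [s' [_ h [-> ->]]]] ->]]|[->|[k [s [s0 sm ->]]]]].
- by left.
- by right; exists k', s'; move: h; rewrite mem_iota add1n ltnS => /andP[].
- by left.
right; apply/mapP; exists (k, s) => //; apply/allpairsPdep; exists k, s; split=> //.
  by rewrite mem_enum.
by rewrite mem_iota s0 add1n ltnS.
Qed.

(** The clauses of [generic] and [separated] are the arguments of the two factors of [ker] at pairs
    of nodes. Since [ker] vanishes on the diagonal, nonvanishing also shows that the nodes are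
    distinct. *)
Lemma nodes_ker a l z m : a != 0 -> l != 0 -> zpos z -> separated z m -> generic a l z m ->
  uniq (nodes a z m) /\ {in nodes a z m &, forall x y, x != y -> ker l x y != 0}.
Proof.
move=> a0 l0 z0 sz [g1 g2 g3].
have mle k : (m k <= \sum_(j < n) m j)%N by rewrite (bigD1 k) //= leq_addr.
have nz k s : a * q ^+ s * z k != 0 by rewrite !mulf_neq0 // expf_neq0.
have E k s : a * q ^+ s * z k = a * z k * q ^+ s by ring.
have n1 k s : (0 < s)%N -> (s <= m k)%N -> ker l 1 (a * q ^+ s * z k) != 0.
  move=> s0 sm; rewrite /ker invr1 mulr1 !mul1r.
  have ile : (s <= 3 * \sum_(j < n) m j)%N by have := mle k; lia.
  by rewrite mulf_neq0 // ?thV_neq0 // E ?g1 ?g2.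
have n2 k s j t : (s <= m k)%N -> (t <= m j)%N -> (k, s) != (j, t) ->
    ker l (a * q ^+ s * z k) (a * q ^+ t * z j) != 0.
  move=> sm tm ne; rewrite /ker !mulf_neq0 // ?invr_neq0 //.
    have := sz k j s t sm tm ne; congr (th _ != 0).
    by have := z0 j => zj; field_pow q q0.
  have := g3 k j (s + t)%N; rewrite (_ : a * q ^+ s * z k * (a * q ^+ t * z j) = a ^+ 2 * z k * z j * q ^+ (s + t)); last by field_pow q q0.
  by apply; have := mle k; have := mle j; lia.
have ker0 x : x != 0 -> ker l x x = 0 by move=> x0; rewrite /ker divff // th1 !mul0r.
split.
  rewrite /nodes cons_uniq; apply/andP; split.
    apply/negP => /mapP[[k s] /allpairsPdep[k' [s' [_ h [-> ->]]]] /= e].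
    move: h; rewrite mem_iota add1n ltnS => /andP[s0 sm].
    by have := n1 _ _ s0 sm; rewrite -e ker0 ?oner_neq0 // eqxx.
  rewrite map_inj_in_uniq.
    by rewrite allpairs_uniq_dep ?enum_uniq // => [k _|[k s] [k' s'] _ _ /= [-> ->]] //; exact: iota_uniq.
  move=> [k s] [j t] /allpairsPdep[k' [s' [_ h [-> ->]]]] /allpairsPdep[j' [t' [_ h' [-> ->]]]] /= e.
  move: h h'; rewrite !mem_iota !add1n !ltnS => /andP[s0 sm] /andP[t0 tm].
  apply/eqP/negPn/negP => ne.
  by have := n2 _ _ _ _ sm tm ne; rewrite e ker0 // eqxx.
move=> x y /nodesP[->|[k [s [s0 sm ->]]]] /nodesP[->|[j [t [t0 tm ->]]]].
- by rewrite eqxx.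
- by move=> _; exact: n1.
- by move=> _; rewrite ker_anti ?oner_neq0 // oppr_eq0 n1.
- move=> ne; apply: n2 => //; apply: contraNneq ne => -[-> ->]; exact: eqxx.
Qed.

Lemma cleared_sum_generic M m (a b c d e : F) z :
  (\sum_(k < n) m k = M)%N -> (forall k, m k < N)%N -> (0 < N)%N ->
  a != 0 -> b != 0 -> c != 0 -> d != 0 -> e != 0 -> zpos z ->
  a ^+ 2 * q ^+ (1 + M) = b * c * d * e ->
  separated z m -> generic a (b * c) z m ->
  (forall i, (i < M)%N -> th (a * q / d * q ^+ i) != 0) ->
  (forall i, (i < M)%N -> th (a * q / e * q ^+ i) != 0) ->
  cleared_sum a b c d e z m = cleared_rhs th q a b c d z m.
Proof.
elim/ltn_ind: M m a b c d e z => M IH m a b c d e z mM mN N0 a0 b0 c0 d0 e0 z0 bal sz gz gd ge.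
set l := b * c in gz; have l0 : l != 0 by rewrite mulf_neq0.
have -> : b = l / c by rewrite /l mulfK.
have vz := separated_vdm sz z0.
have ha k : th (a * z k) != 0.
  by case: gz => g1 _ _; have := g1 k 0%N isT; rewrite mulr1.
have pd : pc (a * q / d) M != 0 by apply: poch_neq0.
have pe : pc (a * q / e) M != 0 by apply: poch_neq0.
have aqe : a * q / e != 0 by rewrite !mulf_neq0 ?invr_neq0.
(* By the balancing condition this symbol is, up to a unit, the reversal of [pc (a * q / e) M]. *)
have pl : pc (a * q / (l * d)) M != 0.
  move: pe; rewrite poch_inv // mulf_eq0 negb_or => /andP[_].
  congr (pc _ _ != 0).
  transitivity (a * q * e / (a ^+ 2 * q ^+ (1 + M))); first by field_pow q q0.
  by rewrite bal -/l; field; rewrite l0 d0 e0.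
pose u0 := [seq a * q / (l * d) * q ^+ i | i <- iota 0 M].
pose B := (pc (a * q / d) M * pc (a * q / (l * d)) M)^-1
  * \prod_(k < n) (pc (a * q * z k) (m k) * pc (a * q * z k / l) (m k)).
pose f (y : {ffun 'I_n -> 'I_N}) :=
  (phi_coef a l d e z m (fun k => y k : nat), phi_params a l z m (fun k => y k : nat)).
(* The right-hand side joins the sum as one more term, so that the identity becomes the vanishing of
   a single combination. *)
pose r := (- B, u0) :: [seq f y | y <- [seq y <- index_enum {ffun 'I_n -> 'I_N} | below m y]].
have rE x : x != 0 -> \sum_(t <- r) t.1 * \prod_(u <- t.2) phi l u x =
    cleared_sum a (l / x) x d e z m - cleared_rhs th q a (l / x) x d z m.
  move=> x0; rewrite /r big_cons [X in _ + X]big_map [X in _ + X]big_filter /= addrC.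
  rewrite (cleared_rhs_phi a z m l0 x0 d0) mM -/B -/u0 mulNr; congr (_ - _).
  by apply: eq_bigr => y _; rewrite -cleared_term_phi.
apply/eqP; rewrite -subr_eq0; apply/eqP; rewrite -rE //.
have [un kn] := nodes_ker a0 l0 z0 sz gz.
have nz x : x \in nodes a z m -> x != 0.
  by move=> /nodesP[->|[k [s [_ _ ->]]]]; rewrite ?oner_neq0 // !mulf_neq0 // expf_neq0.
have rP t : t \in r -> size t.2 = M /\ all (fun u => u != 0) t.2.
  rewrite inE => /orP[/eqP ->|/mapP[y]].
    rewrite /= size_map size_iota; split=> //; apply/allP => u /mapP[i _ ->].
    by rewrite !mulf_neq0 ?invr_neq0 ?expf_neq0 // mulf_neq0.
  rewrite mem_filter => /andP[/forallP ym _] -> /=; rewrite size_phi_params //; split=> //.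
  rewrite all_cat; apply/andP; split; apply/allP => u.
    by move=> /mapP[i _ ->]; rewrite expf_neq0.
  by move=> /allpairsPdep[k [i [_ _ ->]]]; rewrite !mulf_neq0 ?invr_neq0 ?expf_neq0.
rewrite big_seq_cond.
apply: (@interpolation_vanish F F F (fun x => x != 0) (fun u => u != 0) (phi l) (ker l)
   _ _ _ r _ _ _ M (nodes a z m)) => //.
- by move=> x y; exact: ker_anti.
- by move=> u x y v *; apply: three_term.
- by move=> t /andP[/rP[]].
- by move=> t /andP[/rP[]].
- by rewrite size_nodes mM.
- by apply/allP => x /nz.
move=> x xn; rewrite -big_seq_cond rE ?nz //; apply/eqP; rewrite subr_eq0; apply/eqP.
case/nodesP: xn => [->|[ o [s [s0 sm xE]]]].
  by rewrite divr1 cleared_sum_node1 ?mM.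
have zo := z0 o; have qs0 : q ^+ s != 0 by rewrite expf_neq0.
have x0 : x != 0 by rewrite xE !mulf_neq0.
have [m' mE] : exists m' : 'I_n -> nat, forall k, m k = (m' k + single o s k)%N.
  exists (fun k => m k - single o s k)%N => k.
  by rewrite subnK // /single; case: eqP => // ->.
have mfE : m = (fun k => m' k + single o s k)%N by apply: funext.
set b1 := l / x; have b10 : b1 != 0 by rewrite mulf_neq0 ?invr_neq0.
have ME : (M = \sum_(k < n) m' k + s)%N.
  by rewrite -mM mfE big_split /= sum_dl.
have mle k : (m k <= M)%N by rewrite -mM (bigD1 k) //= leq_addr.
have bal1 : a ^+ 2 * q ^+ (1 + M) = b1 * x * d * e by rewrite bal /b1 divfK.
have z'0 : zpos (qshift q z (single o s)) by move=> k; rewrite mulf_neq0 // expf_neq0.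
have sz' := separated_shift sz z0 mE.
have gz' := generic_shift gz mE l0.
have vz' := separated_vdm sz' z'0.
have ha' k : th (a * q ^+ s * qshift q z (single o s) k) != 0.
  case: gz' => g1 _ _; have := g1 k 0%N isT; by rewrite mulr1.
have hz k : pc (q * z k / z o) (m k) != 0 by apply: (separated_pc o sz z0).
have hz' k : pc (q * qshift q z (single o s) k / qshift q z (single o s) o) (m' k) != 0.
  exact: (separated_pc o sz' z'0).
have ht j : j != o -> th (z o / z j) != 0.
  move=> jo; have := sz o j 0%N 0%N isT isT; rewrite !mul1r; apply.
  by rewrite xpair_eqE andbT eq_sym.
have hzo j : j != o -> pc (q * z o / z j) s != 0 by move=> _; apply: (separated_pc j sz z0).
have hm j : pc (a * q ^+ (1 + m j) * z j) s != 0.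
  apply: poch_neq0 => i is_; case: gz => g1 _ _.
  have := g1 j (1 + m j + i)%N; rewrite mM.
  have -> : a * z j * q ^+ (1 + m j + i) = a * q ^+ (1 + m j) * z j * q ^+ i by field_pow q q0.
  by apply; move: (mle j) (mle o) is_ sm; clear; lia.
rewrite mfE in bal1 hz hm mM *.
rewrite (cleared_sum_shift (c := x)) //; last 2 first.
- by move=> k; rewrite -mE.
- by move=> y' hy'; apply: cleared_term_shift.
have sM : (s <= M)%N by rewrite ME leq_addl.
have shE u i : a * q ^+ s * q / u * q ^+ i = a * q / u * q ^+ (s + i) by rewrite exprD; ring.
rewrite (IH (M - s)%N) //.
- by symmetry; apply: cleared_rhs_shift => //; rewrite mM.
- by rewrite ltn_subrL s0 (leq_trans s0 sM).
- by rewrite ME addnK.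
- by move=> k; apply: leq_ltn_trans (mN k); rewrite mfE leq_addr.
- by rewrite mulf_neq0.
- by rewrite mulf_neq0.
(* [a ^+ 2] gains q^(2s) and the power of [q] loses q^s; on the right [b] gains q^s. *)
- transitivity (a ^+ 2 * q ^+ (1 + M) * q ^+ s); last by rewrite bal1; ring.
  have -> : (1 + M = 1 + (M - s) + s)%N by rewrite -addnA subnK.
  by rewrite [q ^+ (_ + _ + s)]exprD; ring.
- have -> : b1 * q ^+ s * x = l * q ^+ s by rewrite /b1; field.
  exact: gz'.
- by move=> i ilt; rewrite shE; apply: gd; rewrite -(subnKC sM) ltn_add2l.
- by move=> i ilt; rewrite shE; apply: ge; rewrite -(subnKC sM) ltn_add2l.
Qed.

End Induction.
End Main.

(** * The q-binomial theorem *)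

Section QBinomial.
Variables (F : fieldType) (p : F).
Hypothesis p1 : forall n, 1 - p ^+ n.+1 != 0.

Definition qpoch (n : nat) : F := \prod_(0 <= i < n) (1 - p ^+ i.+1).

Lemma qpoch0 : qpoch 0 = 1. Proof. by rewrite /qpoch big_geq. Qed.
Lemma qpochS n : qpoch n.+1 = qpoch n * (1 - p ^+ n.+1).
Proof. by rewrite /qpoch big_nat_recr. Qed.

Lemma qpoch_neq0 n : qpoch n != 0.
Proof. by elim: n => [|n IH]; rewrite ?qpoch0 ?oner_neq0 // qpochS mulf_neq0. Qed.

Definition qbin (n k : nat) : F := qpoch n / (qpoch k * qpoch (n - k)).

Lemma qbin0 n : qbin n 0 = 1.
Proof. by rewrite /qbin qpoch0 mul1r subn0 divff ?qpoch_neq0. Qed.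

Lemma qbinn n : qbin n n = 1.
Proof. by rewrite /qbin subnn qpoch0 mulr1 divff ?qpoch_neq0. Qed.

Lemma qbinS n k : (k < n)%N -> qbin n.+1 k.+1 = qbin n k.+1 + p ^+ (n - k) * qbin n k.
Proof.
move=> kn; rewrite /qbin subSS -(subnSK kn) !qpochS.
have h1 := qpoch_neq0 k; have h2 := qpoch_neq0 (n - k.+1)%N.
have h3 := p1 k; have h4 := p1 (n - k.+1)%N.
have e : p ^+ n.+1 = p ^+ (n - k.+1).+1 * p ^+ k.+1.
  by rewrite -exprD; congr (p ^+ _); lia.
rewrite e; move: (p ^+ (n - k.+1).+1) (p ^+ k.+1) (qpoch _) (qpoch _) (qpoch n) h1 h2 h3 h4.
by move=> P Q u v w h1 h2 h3 h4; field; rewrite h1 h2 h3 h4.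
Qed.

Lemma qbinomial n (w : F) :
  \prod_(0 <= j < n) (1 - p ^+ j * w) =
  \sum_(0 <= i < n.+1) (-1) ^+ i * p ^+ 'C(i, 2) * qbin n i * w ^+ i.
Proof.
elim: n => [|n IH].
  by rewrite big_geq // big_nat1 qbin0 !mulr1.
rewrite big_nat_recr //= IH mulrBr mulr1.
rewrite [X in X - _]big_nat_recl // [X in _ - X * _]big_nat_recr //=.
rewrite [RHS]big_nat_recl // [X in _ = _ + X]big_nat_recr //=.
rewrite !qbin0 !qbinn.
have E : \sum_(0 <= i < n) (-1) ^+ i.+1 * p ^+ 'C(i.+1, 2) * qbin n.+1 i.+1 * w ^+ i.+1 =
  \sum_(0 <= i < n) (-1) ^+ i.+1 * p ^+ 'C(i.+1, 2) * qbin n i.+1 * w ^+ i.+1 -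
  (\sum_(0 <= i < n) (-1) ^+ i * p ^+ 'C(i, 2) * qbin n i * w ^+ i) * (p ^+ n * w).
  rewrite mulr_suml -sumrB !big_nat; apply: eq_bigr => i /andP[_ ilt].
  rewrite qbinS // binS bin1 !exprS.
  have -> : p ^+ n = p ^+ (n - i) * p ^+ i by rewrite -exprD subnK // ltnW.
  by rewrite exprD; ring.
by rewrite E binS bin1 !exprS exprD; ring.
Qed.
End QBinomial.

(** * Integer exponents and index lattice of the triple product *)

Lemma bin2_mul2 n : (('C(n, 2))%:Z * 2 = n%:Z * (n%:Z - 1))%R.
Proof. by elim: n => [|n IH] //; rewrite binS bin1; lia. Qed.

(** m(m-1)/2 for every integer m, as a natural number, so that it can be an exponent without
    inverting [p]. *)
Definition tri (m : int) : nat :=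
  match m with Posz k => 'C(k, 2) | Negz k => 'C(k.+2, 2) end.

Lemma tri_mul2 m : ((tri m)%:Z * 2 = m * (m - 1))%R.
Proof.
by case: m => k; [exact: bin2_mul2 | rewrite /= bin2_mul2 NegzE; lia].
Qed.

Lemma tri_ge m : ('C(`|m|, 2) <= tri m)%N.
Proof.
by case: m => k //=; rewrite [X in (_ <= X)%N]binS leq_addr.
Qed.

Section Lattice.
Variable N : nat.
Definition lattice_range : seq int := [seq i%:Z - N%:Z | i <- iota 0 (2 * N).+1].

Lemma mem_lattice_range m : (m \in lattice_range) = (`|m| <= N)%N.
Proof.
apply/mapP/idP => [[i hi ->]|h].
  by move: hi; rewrite mem_iota; lia.
by exists (absz (m + N%:Z)); [rewrite mem_iota; lia | lia].
Qed.

Lemma lattice_range_uniq : uniq lattice_range.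
Proof. by rewrite map_inj_uniq ?iota_uniq // => i j; lia. Qed.

(* The parity [e] of [m + n] splits the lattice into two, on each of which
   [(m + n, m - n)] ranges over a product. *)
Lemma lattice_reindex (V : nmodType) (F : int -> int -> V) :
  (forall m n, ((N < `|m|) || (N < `|n|))%N -> F m n = 0) ->
  \sum_(m <- lattice_range) \sum_(n <- lattice_range) F m n =
  \sum_(e <- [:: 0; 1]) \sum_(s <- lattice_range) \sum_(t <- lattice_range) F (s + t + e) (s - t).
Proof.
move=> F0.
pose L := [seq (s, t) | s <- lattice_range, t <- lattice_range].
pose g (e : int) (st : int * int) := (st.1 + st.2 + e, st.1 - st.2).
pose L2 := [seq g e st | e <- [:: 0; 1], st <- L].
have -> : \sum_(m <- lattice_range) \sum_(n <- lattice_range) F m n = \sum_(x <- L) F x.1 x.2.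
  by rewrite big_allpairs_dep.
have -> : \sum_(e <- [:: 0; 1]) \sum_(s <- lattice_range) \sum_(t <- lattice_range) F (s + t + e) (s - t)
  = \sum_(x <- L2) F x.1 x.2.
  by rewrite big_allpairs_dep; apply: eq_bigr => e _; rewrite big_allpairs_dep.
have memL x : (x \in L) = (`|x.1| <= N)%N && (`|x.2| <= N)%N.
  rewrite -!mem_lattice_range; case: x => s t; apply/allpairsP/andP => [[[s' t'] [h1 h2 [-> ->]]]//|[h1 h2]].
  by exists (s, t).
have uL : uniq L.
  by apply: allpairs_uniq; rewrite ?lattice_range_uniq // => -[? ?] [? ?] _ _ [-> ->].
have uL2 : uniq L2.
  have mem01 e st : (e, st) \in [seq (x, y) | x <- [:: 0; 1 : int], y <- L] -> e = 0 \/ e = 1.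
    by move=> /allpairsP[[a b] [/= ha _ [-> _]]]; move: ha; rewrite !inE => /orP[] /eqP ->; auto.
  apply: allpairs_uniq => // -[e [s t]] [e' [s' t']] /mem01 ha /mem01 ha' /= [E1 E2].
  have ee : e = e' by lia.
  by rewrite ee in E1 *; congr (_, (_, _)); lia.
(* The new index set covers more than the square; outside it [F] vanishes by [F0]. *)
rewrite [RHS](bigID (fun x => x \in L)) /= [X in _ = _ + X]big1 ?addr0; last first.
  by move=> x; rewrite memL negb_and -!ltnNge; exact: F0.
rewrite -[RHS]big_filter; apply: perm_big; apply: uniq_perm => // [|x]; first exact: filter_uniq.
rewrite mem_filter; case xL: (x \in L) => //=; symmetry; apply/allpairsP.
move: xL; rewrite memL; case: x => m n /= /andP[hm hn].
(* The inverse substitution: m + n = 2s + e. *)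
pose e := ((m + n) %% 2)%Z; pose s := ((m + n) %/ 2)%Z.
have E := divz_eq (m + n) 2; rewrite -/e -/s in E.
have he : e = 0 \/ e = 1.
  have := modz_ge0 (m + n) (isT : 2 != 0 :> int); have := ltz_pmod (m + n) (isT : 0 < 2 :> int).
  rewrite -/e; lia.
exists (e, (s, m - s - e)); split; rewrite /g /=.
- by rewrite !inE; case: he => ->.
- by rewrite memL /=; case: he => he; rewrite he in E *; lia.
- by congr (_, _); lia.
Qed.
End Lattice.

Local Open Scope classical_set_scope.

(** * Analytic properties of theta *)

Lemma geometric_sum_le (R : realType) (r : R) k : 0 <= r -> r < 1 ->
  \sum_(0 <= i < k) r ^+ i <= (1 - r)^-1.
Proof.
move=> r0 r1; rewrite -[leRHS]mul1r ler_pdivlMr ?subr_gt0 // mulrC big_mkord.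
by rewrite -opprB mulNr -subrX1 opprB lerBlDr lerDl exprn_ge0.
Qed.

(** From [1 + x <= expR x]; the bound is uniform in the start and the length of the product. *)
Lemma prod_geometric_le (R : realType) (c r : R) : 0 <= c -> 0 <= r -> r < 1 ->
  forall m k, \prod_(m <= j < m + k) (1 + c * r ^+ j) <= expR (c / (1 - r)).
Proof.
move=> c0 r0 r1 m k.
apply: (@le_trans _ _ (expR (\sum_(m <= j < m + k) c * r ^+ j))).
  elim: k => [|k IH]; first by rewrite addn0 !big_geq // expR0.
  rewrite addnS !big_nat_recr ?leq_addr //= expRD ler_pM ?expR_ge1Dx //.
    by apply: prodr_ge0 => j _; rewrite addr_ge0 // mulr_ge0 // exprn_ge0.
  by rewrite addr_ge0 // mulr_ge0 // exprn_ge0.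
rewrite ler_expR -mulr_sumr ler_wpM2l // -{1}[m]add0n big_addn addKn.
apply: le_trans (geometric_sum_le k r0 r1); rewrite big_nat [leRHS]big_nat.
by apply: ler_sum => i _; rewrite exprD ler_piMr ?exprn_ge0 // exprn_ile1 // ltW.
Qed.

Lemma cvgn_prod (K : numFieldType) (I : Type) (s : seq I) (P : pred I)
    (f : I -> nat -> K) (l : I -> K) :
  (forall i, P i -> f i @ \oo --> l i) ->
  (fun n => \prod_(i <- s | P i) f i n) @ \oo --> \prod_(i <- s | P i) l i.
Proof. by move=> h; apply: cvg_big => //; exact: mul_continuous. Qed.

Lemma cvgn_sum (K : numFieldType) (I : Type) (s : seq I) (P : pred I)
    (f : I -> nat -> K) (l : I -> K) :
  (forall i, P i -> f i @ \oo --> l i) ->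
  (fun n => \sum_(i <- s | P i) f i n) @ \oo --> \sum_(i <- s | P i) l i.
Proof. by move=> h; apply: cvg_big => //; exact: add_continuous. Qed.

Section Analysis.
(* An abstract [C] with a real-valued norm [nm] stands for [R[i]] because the norm
   topology is inferred on a [numClosedFieldType] but not on [R[i]] itself. *)
Variables (C : numClosedFieldType) (R : realType) (nm : C -> R).
Hypothesis nmM : forall x y, nm (x * y) = nm x * nm y.
Hypothesis nmD : forall x y, nm (x + y) <= nm x + nm y.
Hypothesis nmN : forall x, nm (- x) = nm x.
Hypothesis nm_ge0 : forall x, 0 <= nm x.
Hypothesis nm_eq0 : forall x, (nm x == 0) = (x == 0).
Hypothesis nm_cvgP : forall (u : nat -> C) (l : C),
  u @ \oo --> l <-> forall e : R, 0 < e -> exists n0, forall n, (n0 <= n)%N -> nm (u n - l) < e.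
Hypothesis geometric_cvg : forall (u : nat -> C) (K r : R), 0 <= r -> r < 1 ->
  (forall N k, nm (u (N + k)%N - u N) <= K * r ^+ N) ->
  exists2 l, u @ \oo --> l & forall N, nm (u N - l) <= K * r ^+ N.

Lemma nm0 : nm 0 = 0. Proof. by apply/eqP; rewrite nm_eq0. Qed.

Lemma nm1 : nm 1 = 1.
Proof.
have n1 : nm 1 != 0 by rewrite nm_eq0 oner_neq0.
by apply: (mulfI n1); rewrite -nmM !mulr1.
Qed.

Lemma nmX x n : nm (x ^+ n) = nm x ^+ n.
Proof. by elim: n => [|n IH]; rewrite ?expr0 ?nm1 // !exprS nmM IH. Qed.

Lemma nmV x : nm x^-1 = (nm x)^-1.
Proof.
have [->|x0] := eqVneq x 0; first by rewrite !(invr0, nm0).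
have nx0 : nm x != 0 by rewrite nm_eq0.
by apply: (mulfI nx0); rewrite -nmM !divff ?nm1.
Qed.

Lemma nmB x y : nm (x - y) <= nm x + nm y.
Proof. by rewrite -(nmN y); exact: nmD. Qed.

Lemma nm_distC x y : nm (x - y) = nm (y - x).
Proof. by rewrite -nmN opprB. Qed.

Lemma nm_sum (I : Type) (s : seq I) (P : pred I) (f : I -> C) :
  nm (\sum_(i <- s | P i) f i) <= \sum_(i <- s | P i) nm (f i).
Proof.
elim/big_rec2: _ => [|i y1 y2 _ h]; first by rewrite nm0.
by apply: (le_trans (nmD _ _)); rewrite lerD2l.
Qed.

Lemma nm_prod (I : Type) (s : seq I) (P : pred I) (f : I -> C) :
  nm (\prod_(i <- s | P i) f i) = \prod_(i <- s | P i) nm (f i).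
Proof. by elim/big_rec2: _ => [|i y1 y2 _ h]; rewrite ?nm1 // nmM h. Qed.

Lemma cvg_nm0 (u : nat -> C) (l : C) (v : nat -> R) : (forall n, nm (u n - l) <= v n) ->
  v @ \oo --> (0 : R) -> u @ \oo --> l.
Proof.
move=> uv /cvgrPdist_lt v0; apply/nm_cvgP => e /v0 [n0 _ h]; exists n0 => n nn.
have := h n nn; rewrite /= sub0r normrN => /(le_lt_trans _); apply.
exact: le_trans (uv n) (ler_norm _).
Qed.

Lemma cvgn_unique (u : nat -> C) (l l' : C) : u @ \oo --> l -> u @ \oo --> l' -> l = l'.
Proof. by move=> h h'; apply: (cvg_unique (@norm_hausdorff _ _) h h'). Qed.

Section Tail.
Variables (c r : R).
Hypotheses (c0 : 0 <= c) (r0 : 0 <= r) (r1 : r < 1).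
Let B := expR (c / (1 - r)).

Lemma nm_tail_prod_le (f : nat -> C) m k : (forall j, nm (f j - 1) <= c * r ^+ j) ->
  nm (\prod_(m <= j < m + k) f j) <= B.
Proof.
move=> hf; apply: le_trans (prod_geometric_le c0 r0 r1 m k); rewrite nm_prod.
apply: ler_prod => j _; rewrite nm_ge0 /= -[f j](subrK 1) addrC.
by apply: le_trans (nmD _ _) _; rewrite nm1 lerD2l.
Qed.

(** The increments of the partial products telescope, each being a bounded product times
    [f j - 1]. *)
Lemma nm_tail_prod_sub1 (f : nat -> C) m k : (forall j, nm (f j - 1) <= c * r ^+ j) ->
  nm (\prod_(m <= j < m + k) f j - 1) <= B * c / (1 - r) * r ^+ m.
Proof.
move=> hf.
apply: (@le_trans _ _ (B * c * r ^+ m * \sum_(0 <= i < k) r ^+ i)); last first.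
  rewrite [leRHS]mulrAC ler_wpM2l ?geometric_sum_le //.
  by rewrite !mulr_ge0 ?expR_ge0 ?exprn_ge0.
elim: k => [|k IH]; first by rewrite addn0 !big_geq // subrr nm0 mulr0.
rewrite addnS !big_nat_recr ?leq_addr //=; set Q := \prod_(_ <= _ < _) _ in IH *.
have -> : Q * f (m + k)%N - 1 = (Q - 1) + Q * (f (m + k)%N - 1) by ring.
apply: le_trans (nmD _ _) _; rewrite [leRHS]mulrDr lerD //.
rewrite nmM -!mulrA -exprD ler_pM //; exact: nm_tail_prod_le.
Qed.
End Tail.

(** * Convergence, inversion, continuity and zeros of theta *)

Section Theta.
Variable p : C.
Hypothesis p1 : nm p < 1.

Definition thetaN (N : nat) (x : C) : C :=
  \prod_(0 <= j < N) ((1 - p ^+ j * x) * (1 - p ^+ j.+1 / x)).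

(** A rate in [[nm p, 1)] that is positive also for [p = 0]. *)
Let r : R := (1 + nm p) / 2.
Let r0 : 0 < r. Proof. by rewrite divr_gt0 // ltr_pwDl. Qed.
Let r1 : r < 1. Proof. by rewrite ltr_pdivrMr // mul1r; have := p1; lra. Qed.
Let pr : nm p <= r. Proof. by rewrite ler_pdivlMr //; have := p1; lra. Qed.

Lemma factor_sub1 (rho : R) x j : nm x <= rho -> nm x^-1 <= rho ->
  nm ((1 - p ^+ j * x) * (1 - p ^+ j.+1 / x) - 1) <= (2 * rho + 1) * r ^+ j.
Proof.
move=> hx hv; have rho0 : 0 <= rho := le_trans (nm_ge0 x) hx.
have pj k : (j <= k)%N -> nm (p ^+ k) <= r ^+ j.
  move=> jk; rewrite nmX; apply: (@le_trans _ _ (r ^+ k)).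
    by rewrite lerXn2r ?nnegrE ?nm_ge0 // ltW.
  by rewrite ler_wiXn2l // ltW.
have [x0|x0] := eqVneq x 0.
  by rewrite x0 invr0 !mulr0 !subr0 mulr1 subrr nm0 mulr_ge0 ?exprn_ge0 ?ltW // ltr_wpDl // mulr_ge0.
have -> : (1 - p ^+ j * x) * (1 - p ^+ j.+1 / x) - 1 =
   - (p ^+ j * x) - p ^+ j.+1 * x^-1 + p ^+ (j + j.+1) by rewrite exprD; field.
apply: le_trans (nmD _ _) _.
have -> : (2 * rho + 1) * r ^+ j = (r ^+ j * rho + r ^+ j * rho) + r ^+ j by ring.
rewrite lerD ?pj ?leq_addr //.
apply: le_trans (nmB _ _) _; rewrite nmN !nmM lerD // ler_pM ?nm_ge0 ?pj //.
Qed.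

Lemma thetaN_cvg_rate (rho : R) : exists2 K : R, 0 <= K &
  forall x, nm x <= rho -> nm x^-1 <= rho ->
  [/\ (thetaN^~ x) @ \oo --> theta p x,
      forall N, nm (thetaN N x - theta p x) <= K * r ^+ N &
      forall m k, nm (\prod_(m <= j < m + k) ((1 - p ^+ j * x) * (1 - p ^+ j.+1 / x)) - 1)
        <= K * r ^+ m].
Proof.
have [rho0|rho0] := leP 0 rho; last first.
  by exists 0 => // x hx _; have := le_lt_trans hx rho0; rewrite ltNge nm_ge0.
pose c := 2 * rho + 1; have c0 : 0 <= c by rewrite addr_ge0 // mulr_ge0.
have B1 : 1 <= expR (c / (1 - r)) by apply: le_trans (expR_ge1Dx _); rewrite lerDl divr_ge0 // subr_ge0 ltW.
(* Bound of the head times bound of the tail minus 1. The first factor is at least 1, so [K] also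
   bounds the tail alone. *)
pose K := expR (c / (1 - r)) * (expR (c / (1 - r)) * c / (1 - r)).
have K1 : 0 <= expR (c / (1 - r)) * c / (1 - r).
  by rewrite divr_ge0 ?mulr_ge0 ?expR_ge0 // subr_ge0 ltW.
exists K; first by rewrite mulr_ge0 ?expR_ge0.
move=> x hx hv.
pose f j := (1 - p ^+ j * x) * (1 - p ^+ j.+1 / x).
have hf j : nm (f j - 1) <= c * r ^+ j by apply: factor_sub1.
have tail m k := nm_tail_prod_sub1 c0 (ltW r0) r1 m k hf.
have below m k := nm_tail_prod_le c0 (ltW r0) r1 m k hf.
have inc N k : nm (thetaN (N + k) x - thetaN N x) <= K * r ^+ N.
  have -> : thetaN (N + k) x - thetaN N x = thetaN N x * (\prod_(N <= j < N + k) f j - 1).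
    by rewrite /thetaN (big_cat_nat (leq0n N) (leq_addr k N)) /=; ring.
  by rewrite nmM -mulrA ler_pM // ; exact: (below 0%N N).
have [l ul rate] := geometric_cvg (ltW r0) r1 inc.
have -> : theta p x = l by apply: cvg_lim ul; exact: norm_hausdorff.
split=> // m k; apply: le_trans (tail m k) _.
by apply: ler_wpM2r; rewrite ?exprn_ge0 ?(ltW r0) // /K ler_peMl.
Qed.

Lemma thetaN_cvg x : (thetaN^~ x) @ \oo --> theta p x.
Proof.
have [K _ /(_ x) []] // := thetaN_cvg_rate (Num.max (nm x) (nm x^-1)).
  by rewrite le_max lexx.
by rewrite le_max lexx orbT.
Qed.

Lemma theta1 : theta p 1 = 0.
Proof.
apply: (@cvgn_unique (thetaN^~ 1)); first exact: thetaN_cvg.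
apply/nm_cvgP => e e0; exists 1%N => -[//|n] _.
by rewrite /thetaN big_nat_recl // expr0 mul1r subrr !mul0r subrr nm0.
Qed.

Lemma p_expr_cvg0 : (fun n => p ^+ n) @ \oo --> (0 : C).
Proof.
apply: (cvg_nm0 (v := fun n => r ^+ n)).
  by move=> n; rewrite subr0 nmX lerXn2r ?nnegrE ?nm_ge0 // ltW.
by apply: cvg_expr; rewrite ger0_norm // ltW.
Qed.

(** Replacing x by 1/x moves the exponents of both families of factors by one, so only end factors
    differ. *)
Lemma thetaN_inv N x : x != 0 ->
  thetaN N x * (1 - x^-1) * (1 - p ^+ N * x) = (1 - x) * (1 - p ^+ N / x) * thetaN N x^-1.
Proof.
move=> x0; elim: N => [|N IH]; first by rewrite /thetaN !big_geq // !expr0 !mul1r; ring.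
rewrite /thetaN !big_nat_recr //= -!/(thetaN _ _) invrK.
transitivity (thetaN N x * (1 - x^-1) * (1 - p ^+ N * x) * ((1 - p ^+ N.+1 / x) * (1 - p ^+ N.+1 * x))).
  by ring.
by rewrite IH; ring.
Qed.

Lemma theta_inv x : x != 0 -> theta p x^-1 = - theta p x / x.
Proof.
move=> x0; have [->|x1] := eqVneq x 1; first by rewrite invr1 theta1 oppr0 mul0r.
have h y : (fun N => 1 - p ^+ N * y) @ \oo --> (1 : C).
  have e : 1 - 0 * y = 1 by rewrite mul0r subr0.
  rewrite -[X in _ --> X]e.
  by apply: cvgB; [exact: cvg_cst | apply: cvgM; [exact: p_expr_cvg0 | exact: cvg_cst]].
have e : theta p x * (1 - x^-1) * 1 = (1 - x) * 1 * theta p x^-1.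
  apply: (@cvgn_unique (fun N => thetaN N x * (1 - x^-1) * (1 - p ^+ N * x))).
    apply: cvgM; last exact: h.
    by apply: cvgM; [exact: thetaN_cvg | exact: cvg_cst].
  under eq_fun do rewrite thetaN_inv //.
  apply: cvgM; last exact: thetaN_cvg.
  by apply: cvgM; [exact: cvg_cst | exact: h].
have x1' : 1 - x != 0 by rewrite subr_eq0 eq_sym.
apply: (mulfI x1'); rewrite -[LHS]mul1r mulrCA mulrA -e; field.
by rewrite x0.
Qed.

Lemma cvgn_nm_bound (u : nat -> C) l : u @ \oo --> l ->
  exists n0, forall n, (n0 <= n)%N -> nm (u n) <= nm l + 1.
Proof.
move=> /nm_cvgP /(_ 1 ltr01) [n0 h]; exists n0 => n /h hn.
by rewrite -[u n](subrK l) addrC (le_trans (nmD _ _)) // lerD2l ltW.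
Qed.

Lemma rate_small (K e : R) : 0 < e -> exists N, K * r ^+ N < e.
Proof.
move=> e0; have : (fun N => K * r ^+ N) @ \oo --> (0 : R).
  rewrite -[X in _ --> X](mulr0 K).
  apply: cvgM; first exact: cvg_cst.
  by apply: cvg_expr; rewrite ger0_norm // ltW.
move=> /cvgrPdist_lt /(_ _ e0) [n0 _ h]; exists n0; have := h n0 (leqnn _).
by rewrite /= sub0r normrN; apply: le_lt_trans; exact: ler_norm.
Qed.

(** [u] and its inverses eventually stay in an annulus on which [thetaN N] converges uniformly to
    theta. *)
Lemma theta_seq_continuous (u : nat -> C) x : x != 0 -> u @ \oo --> x ->
  (fun n => theta p (u n)) @ \oo --> theta p x.
Proof.
move=> x0 ux.
have vx : (fun n => (u n)^-1) @ \oo --> x^-1 by apply: cvgV.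
have [n1 h1] := cvgn_nm_bound ux; have [n2 h2] := cvgn_nm_bound vx.
pose rho := Num.max (nm x + 1) (nm x^-1 + 1).
have [K K0 hK] := thetaN_cvg_rate rho.
apply/nm_cvgP => e e0; have e3 : 0 < e / 3 by rewrite divr_gt0.
have [N hN] := rate_small K e3.
have : (fun n => thetaN N (u n)) @ \oo --> thetaN N x.
  apply: cvgn_prod => j _; apply: cvgM; (apply: cvgB; first exact: cvg_cst);
  by apply: cvgM => //; exact: cvg_cst.
move=> /nm_cvgP /(_ _ e3) [n3 h3].
exists (maxn n1 (maxn n2 n3)) => n; rewrite !geq_max => /and3P[/h1 g1 /h2 g2 /h3 g3].
have [] := hK (u n); rewrite ?le_max ?g1 ?g2 ?orbT // => _ /(_ N) a1 _.
have [] := hK x; rewrite ?le_max ?lerDl ?ler01 ?orbT // => _ /(_ N) a2 _.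
have -> : theta p (u n) - theta p x = (thetaN N x - theta p x) - (thetaN N (u n) - theta p (u n))
   + (thetaN N (u n) - thetaN N x) by ring.
have t1 := nmD (thetaN N x - theta p x - (thetaN N (u n) - theta p (u n))) (thetaN N (u n) - thetaN N x).
have t2 := nmB (thetaN N x - theta p x) (thetaN N (u n) - theta p (u n)).
by lra.
Qed.

(** Either the limit is nonzero, or [x] is the only zero of the affine function and [u] avoids
    it. *)
Lemma affine_eventually_neq0 (a : C) (u : nat -> C) x : u @ \oo --> x -> (forall n, u n != x) ->
  exists n0, forall n, (n0 <= n)%N -> 1 - a * u n != 0.
Proof.
move=> ux un; have [ax|ax] := eqVneq (1 - a * x) 0.
  exists 0%N => n _; have a0 : a != 0.
    by apply/eqP => a0; move/eqP: ax; rewrite a0 mul0r subr0 oner_eq0.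
  have -> : 1 - a * u n = (1 - a * x) + a * (x - u n) by ring.
  by rewrite ax add0r mulf_neq0 // subr_eq0 eq_sym.
have : (fun n => 1 - a * u n) @ \oo --> 1 - a * x.
  apply: cvgB; first exact: cvg_cst.
  by apply: cvgM => //; exact: cvg_cst.
have e0 : 0 < nm (1 - a * x) by rewrite lt_neqAle nm_ge0 eq_sym nm_eq0 ax.
move=> /nm_cvgP /(_ _ e0) [n0 h]; exists n0 => n /h hn.
by apply: contraTneq hn => ->; rewrite sub0r nmN ltxx.
Qed.

(** Beyond a suitable [J] all tail products lie within 1/2 of 1, so theta vanishes only if one of
    the finitely many affine factors of [thetaN J] does. *)
Lemma theta_isolated_zeros (u : nat -> C) x : x != 0 -> u @ \oo --> x -> (forall n, u n != x) ->
  exists n0, forall n, (n0 <= n)%N -> theta p (u n) != 0.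
Proof.
move=> x0 ux un.
have vx : (fun n => (u n)^-1) @ \oo --> x^-1 by apply: cvgV.
have vn n : (u n)^-1 != x^-1 by rewrite (inj_eq invr_inj).
have [n1 h1] := cvgn_nm_bound ux; have [n2 h2] := cvgn_nm_bound vx.
pose rho := Num.max (nm x + 1) (nm x^-1 + 1).
have [K K0 hK] := thetaN_cvg_rate rho.
have e2 : 0 < 2^-1 :> R by rewrite invr_gt0.
have [J hJ] := rate_small K e2.
have [n3 h3] : exists n0, forall n, (n0 <= n)%N -> thetaN J (u n) != 0.
  elim: (J) => [|j [n0 h]]; first by exists 0%N => n _; rewrite /thetaN big_geq // oner_neq0.
  have [n4 h4] := affine_eventually_neq0 (p ^+ j) ux un.
  have [n5 h5] := affine_eventually_neq0 (p ^+ j.+1) vx vn.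
  exists (maxn n0 (maxn n4 n5)) => n; rewrite !geq_max => /and3P[g0 g4 g5].
  rewrite /thetaN big_nat_recr //= -/(thetaN _ _).
  by rewrite !mulf_neq0 ?h ?h4 ?h5.
exists (maxn n1 (maxn n2 n3)) => n; rewrite !geq_max => /and3P[/h1 g1 /h2 g2 /h3 g3].
have [] := hK (u n); rewrite ?le_max ?g1 ?g2 ?orbT // => cv _ tl.
apply/negP => /eqP th0; rewrite th0 in cv.
(* If theta were 0, some later partial product would be smaller than this, whereas the tail has
   modulus at least 1/2. *)
have e0 : 0 < nm (thetaN J (u n)) / 2.
  by rewrite divr_gt0 // lt_neqAle nm_ge0 eq_sym nm_eq0 g3.
have /nm_cvgP /(_ _ e0) [n0 /(_ (J + n0)%N (leq_addl _ _))] := cv.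
rewrite subr0 /thetaN (big_cat_nat (leq0n J) (leq_addr n0 J)) /= -/(thetaN _ _) nmM.
rewrite ltr_pM2l; last by rewrite lt_neqAle nm_ge0 eq_sym nm_eq0 g3.
set Q := \prod_(_ <= _ < _) _; have := tl J n0; rewrite -/Q => tQ.
have := nmB Q (Q - 1); rewrite opprB addrC subrK nm1 => h.
rewrite ltNge; apply/negP; rewrite negbK; lra.
Qed.

(** * The triple product and an approximation of rank 2 *)

Section Weierstrass.
Hypothesis p0 : p != 0.

Let pS1 n : 1 - p ^+ n.+1 != 0.
Proof.
rewrite subr_eq0; apply/eqP => /(congr1 nm); rewrite nm1 nmX => e.
by have := exprn_ilt1 n.+1 (nm_ge0 p) p1; rewrite -e ltxx.
Qed.

Local Notation qp := (qpoch p).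
Local Notation qb := (qbin p).

Definition jacobi_term (m : int) (x : C) : C := (-1) ^ m * p ^+ tri m * x ^ m.

(** The q-binomial theorem of order 2N at w = x/p^N. Its upper N factors are the 1 - p^j x; in the
    lower ones - x/p^(j+1) is pulled out, leaving 1 - p^(j+1)/x. [E] collects what is pulled out. *)
Lemma thetaN_laurent N x : x != 0 ->
  thetaN N x = \sum_(m <- lattice_range N) qb (2 * N) (absz (N%:Z + m)) * jacobi_term m x.
Proof.
move=> x0; pose w := x / p ^+ N.
have pN0 k : p ^+ k != 0 by rewrite expf_neq0.
pose E := \prod_(0 <= j < N) (- x / p ^+ j.+1).
have EE : E = (- x) ^+ N / p ^+ 'C(N.+1, 2).
  rewrite /E; elim: (N) => [|k IH]; first by rewrite big_geq // expr0 divr1.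
  rewrite big_nat_recr //= IH [X in _ = _ / p ^+ X]binS bin1 exprD exprS [in RHS]exprS.
  by field; rewrite p0 !pN0.
have E0 : E != 0.
  by rewrite EE mulf_neq0 ?invr_eq0 ?pN0 // expf_neq0 // oppr_eq0.
have h : \prod_(0 <= j < 2 * N) (1 - p ^+ j * w) = E * thetaN N x.
  rewrite mul2n -addnn (big_cat_nat (leq0n N) (leq_addr N N)) /=.
  rewrite big_nat_rev /= add0n -{3}[N]add0n big_addn addKn /E /thetaN -!big_split /=.
  rewrite !big_nat; apply: eq_bigr => j /andP[_ jN].
  have e1 : p ^+ N = p ^+ (N - j.+1) * p ^+ j.+1 by rewrite -exprD subnK.
  rewrite [p ^+ (j + N)]exprD /w {1}e1.
  by field; rewrite x0 !pN0.
apply: (mulfI E0); rewrite -h (qbinomial pS1) /lattice_range big_map mulr_sumr.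
rewrite /index_iota subn0; apply: eq_big_seq => i; rewrite mem_iota => /andP[_ hi].
have -> : absz (N%:Z + (i%:Z - N%:Z)) = i by lia.
rewrite EE /jacobi_term /w exprMn exprVn.
have e2 : p ^+ tri (i%:Z - N%:Z) * p ^+ (N * i) = p ^+ 'C(i, 2) * p ^+ 'C(N.+1, 2).
  rewrite -!exprD; congr (p ^+ _).
  have t1 := tri_mul2 (i%:Z - N%:Z); have t2 := bin2_mul2 i; have t3 := bin2_mul2 N.+1.
  nia.
have e3 (y : C) : y != 0 -> y ^ (i%:Z - N%:Z) * y ^+ N = y ^+ i.
  by move=> y0; rewrite [y ^+ N]exprnP -expfzDr // subrK.
rewrite -(e3 (-1)) ?oppr_eq0 ?oner_neq0 // -(e3 x) // (exprNn x) -exprM.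
have -> : p ^+ 'C(i, 2) = p ^+ tri (i%:Z - N%:Z) * p ^+ (N * i) / p ^+ 'C(N.+1, 2).
  by rewrite e2 mulfK.
by field; rewrite !pN0.
Qed.

(** The inverses are products as well, with factors geometrically close to 1, so the same tail
    estimate bounds them. *)
Lemma qp_bounds : exists2 B : R, 1 <= B &
  [/\ forall n, nm (qp n) <= B, forall n, nm (qp n)^-1 <= B &
      forall m k, (m <= k)%N -> nm (qp k - qp m) <= B * r ^+ m].
Proof.
have r1' : 0 < 1 - r by rewrite subr_gt0.
have nmp n : nm (p ^+ n.+1) <= r ^+ n.+1 by rewrite nmX lerXn2r ?nnegrE ?nm_ge0 // ltW.
have rS n : r ^+ n.+1 <= r ^+ n by rewrite exprS ler_piMl ?exprn_ge0 // ltW.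
have h1 j : nm ((1 - p ^+ j.+1) - 1) <= 1 * r ^+ j.
  by rewrite mul1r addrAC subrr sub0r nmN (le_trans (nmp j)).
have h2 j : nm ((1 - p ^+ j.+1)^-1 - 1) <= (1 - r)^-1 * r ^+ j.
  have -> : (1 - p ^+ j.+1)^-1 - 1 = p ^+ j.+1 * (1 - p ^+ j.+1)^-1.
    by have := pS1 j; move: (p ^+ j.+1) => P P1; field.
  rewrite nmM nmV mulrC; apply: ler_pM; rewrite ?invr_ge0 ?nm_ge0 //.
    rewrite lef_pV2 ?posrE //; last by rewrite lt_neqAle nm_ge0 eq_sym nm_eq0 pS1.
    have := nmD (1 - p ^+ j.+1) (p ^+ j.+1); rewrite subrK nm1 => t.
    have : r ^+ j.+1 <= r by rewrite -{2}(expr1 r) ler_wiXn2l // ltW.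
    have := nmp j; lra.
  exact: le_trans (nmp j) (rS j).
have c1 : (0 : R) <= 1 by [].
have c2 : 0 <= (1 - r)^-1 by rewrite invr_ge0 ltW.
have b1 := nm_tail_prod_le c1 (ltW r0) r1 0%N _ h1.
have b2 := nm_tail_prod_le c2 (ltW r0) r1 0%N _ h2.
have b3 := nm_tail_prod_sub1 c1 (ltW r0) r1 _ _ h1.
set B1 := expR _ in b1; set B2 := expR _ in b2; set B3 := _ / _ in b3.
pose B := Num.max 1 (Num.max B1 (Num.max B2 (B1 * B3))).
have le1 n : nm (qp n) <= B1 by have := b1 n; rewrite add0n.
exists B; first by rewrite /B le_max lexx.
split=> [n|n|m k mk].
- by apply: le_trans (le1 n) _; rewrite /B !le_max lexx !orbT.
- have := b2 n; rewrite add0n prodfV => /le_trans; apply.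
  by rewrite /B !le_max lexx !orbT.
- have -> : qp k - qp m = qp m * (\prod_(m <= j < m + (k - m)) (1 - p ^+ j.+1) - 1).
    by rewrite subnKC // /qpoch (big_cat_nat (leq0n m) mk) /=; ring.
  rewrite nmM; apply: (@le_trans _ _ (B1 * (B3 * r ^+ m))).
    by rewrite ler_pM ?nm_ge0.
  rewrite mulrA; apply: ler_wpM2r; first by rewrite exprn_ge0 // ltW.
  by rewrite /B !le_max lexx !orbT.
Qed.

(** The quadratic exponent of [p] outweighs x^m and still leaves a geometric factor. *)
Lemma jacobi_term_bound x : x != 0 -> exists2 K : R, 0 <= K & forall m, nm (jacobi_term m x) <= K * r ^+ `|m|%N.
Proof.
move=> x0.
pose rho := Num.max (nm x) (nm x^-1).
have rho0 : 0 <= rho by rewrite le_max nm_ge0.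
pose a := rho / r; have a0 : 0 <= a by rewrite divr_ge0 // ltW.
have a1 : 1 <= 1 + a by rewrite lerDl.
have [K hK] : exists K, forall k, (K <= k)%N -> r ^+ k * a <= 1.
  have [K hK] := rate_small a (ltr01 : 0 < 1 :> R).
  exists K => k Kk; rewrite mulrC; apply: le_trans (ltW hK).
  by rewrite ler_wpM2l // ler_wiXn2l // ltW.
(* Consecutive values have ratio [r ^+ k * a], which is at most 1 from [K] on; up to [K] the crude
   bound suffices. *)
have U k : r ^+ 'C(k, 2) * a ^+ k <= (1 + a) ^+ K.
  have [kK|Kk] := leqP k K.
    rewrite (@le_trans _ _ (a ^+ k)) //.
      by rewrite ler_piMl ?exprn_ge0 // exprn_ile1 // ltW.
    apply: (@le_trans _ _ ((1 + a) ^+ k)).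
      by rewrite lerXn2r ?nnegrE ?addr_ge0 // lerDr.
    by rewrite ler_weXn2l.
  elim: k Kk => // k IH; rewrite ltnS => Kk.
  have Ik : r ^+ 'C(k, 2) * a ^+ k <= (1 + a) ^+ K.
    move: Kk; rewrite leq_eqVlt => /orP[/eqP Kk|]; last exact: IH.
    rewrite -Kk (@le_trans _ _ (a ^+ K)) //.
      by rewrite ler_piMl ?exprn_ge0 // exprn_ile1 // ltW.
    by rewrite lerXn2r ?nnegrE ?addr_ge0 // lerDr.
  rewrite binS bin1 exprD exprSr.
  have -> : r ^+ 'C(k, 2) * r ^+ k * (a ^+ k * a) = (r ^+ 'C(k, 2) * a ^+ k) * (r ^+ k * a) by ring.
  apply: le_trans Ik; rewrite ler_piMr ?hK //.
  by rewrite mulr_ge0 ?exprn_ge0 // ltW.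
exists ((1 + a) ^+ K); first by rewrite exprn_ge0 // addr_ge0.
move=> m.
have sgn : nm ((-1) ^ m) = 1.
  case: m => k; rewrite ?NegzE -?exprnN -?exprnP ?nmV nmX nmN nm1 expr1n ?invr1 //.
rewrite /jacobi_term !nmM sgn mul1r.
have xm : nm (x ^ m) <= rho ^+ `|m|%N.
  case: m {sgn} => k; rewrite ?NegzE -?exprnN -?exprnP /=.
    by rewrite nmX lerXn2r ?nnegrE ?nm_ge0 // /rho le_max lexx.
  by rewrite -exprVn nmX lerXn2r ?nnegrE ?nm_ge0 // /rho le_max lexx orbT.
have pm : nm (p ^+ tri m) <= r ^+ 'C(`|m|, 2).
  rewrite nmX; apply: (@le_trans _ _ (r ^+ tri m)).
    by rewrite lerXn2r ?nnegrE ?nm_ge0 // ltW.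
  by rewrite ler_wiXn2l ?tri_ge // ltW.
apply: (@le_trans _ _ (r ^+ 'C(`|m|, 2) * rho ^+ `|m|)); first by rewrite ler_pM ?nm_ge0.
have -> : rho ^+ `|m| = a ^+ `|m| * r ^+ `|m|.
  by rewrite -exprMn /a divfK // gt_eqF.
by rewrite mulrA; apply: ler_wpM2r (U _); rewrite exprn_ge0 // ltW.
Qed.

(* [qcoef N m] tends to the constant [qkappa N] of the triple product, at the rate
   given below; it is 0 for [`|m| > N], where the natural-number index of [qbin]
   would be meaningless. *)
Definition qcoef N (m : int) : C := if (`|m| <= N)%N then qb (2 * N) (absz (N%:Z + m)) else 0.
Definition qkappa N : C := qp (2 * N) / qp N ^+ 2.

(** The coefficients deviate from [qkappa N] by O(r^(N-|m|)), which is bad near |m| = N; the weight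
    r^|m|, supplied later by [jacobi_term_bound], makes the estimate uniform in [m]. *)
Lemma qcoef_bound : exists2 K : R, 0 <= K &
  [/\ forall N m, nm (qcoef N m) <= K, forall N, nm (qkappa N) <= K &
      forall N m, nm (qcoef N m - qkappa N) * r ^+ `|m|%N <= K * r ^+ N].
Proof.
have [B B1 [b1 b2 b3]] := qp_bounds.
have B0 : 0 <= B := le_trans ler01 B1.
have BX i j : (i <= j)%N -> B ^+ i <= B ^+ j by move=> ij; rewrite ler_weXn2l.
have r0' : 0 <= r by rewrite ltW.
have b3' j u v : (j <= u)%N -> (j <= v)%N -> nm (qp u - qp v) <= B * r ^+ j.
  move=> ju jv; have [uv|/ltnW uv] := leqP u v.
    by rewrite nm_distC (le_trans (b3 _ _ uv)) // ler_wpM2l // ler_wiXn2l // ltW.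
  by rewrite (le_trans (b3 _ _ uv)) // ler_wpM2l // ler_wiXn2l // ltW.
have M3 N u v : nm (qp (2 * N) / (qp u * qp v)) <= B ^+ 3.
  rewrite invfM !nmM !exprS expr0 mulr1 ler_pM ?mulr_ge0 ?nm_ge0 //.
  by rewrite ler_pM ?nm_ge0.
(* Two products of a bounded factor with a difference give 2 B^2, the five remaining factors B^5. *)
pose K := 2 * B ^+ 7.
have K3 : B ^+ 3 <= K.
  by apply: le_trans (BX 3%N 7%N isT) _; rewrite ler_peMl ?exprn_ge0 // ler1n.
exists K; first by rewrite mulr_ge0 // exprn_ge0.
have hk N : nm (qkappa N) <= B ^+ 3 by rewrite /qkappa expr2.
have hq N m : nm (qcoef N m) <= B ^+ 3.
  by rewrite /qcoef; case: ifP => _; [exact: M3 | rewrite nm0 exprn_ge0].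
split=> [N m|N|N m].
- exact: le_trans (hq N m) K3.
- exact: le_trans (hk N) K3.
rewrite /qcoef; case: ifP => [mN|/negbT]; last first.
  rewrite -ltnNge => Nm; rewrite sub0r nmN ler_pM ?nm_ge0 ?exprn_ge0 //.
    exact: le_trans (hk N) K3.
  by rewrite ler_wiXn2l //; [exact: ltW r1 | exact: ltnW].
set u := absz _; rewrite /qbin; set v := (2 * N - u)%N.
have uN : (N - `|m| <= u)%N by rewrite /u; move: mN; clear; lia.
have vN : (N - `|m| <= v)%N by rewrite /v /u; move: mN; clear; lia.
have NN : (N - `|m| <= N)%N by rewrite leq_subr.
have -> : r ^+ N = r ^+ (N - `|m|) * r ^+ `|m| by rewrite -exprD subnK.
rewrite mulrA; apply: ler_wpM2r; first by rewrite exprn_ge0.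
have -> : qp (2 * N) / (qp u * qp v) - qkappa N =
   (qp N * (qp N - qp v) + qp v * (qp N - qp u)) * (qp (2 * N) * (qp u)^-1 * (qp v)^-1 * (qp N)^-1 * (qp N)^-1).
  by rewrite /qkappa; field; rewrite !qpoch_neq0.
rewrite nmM; have -> : K * r ^+ (N - `|m|) = (B * (B * r ^+ (N - `|m|)) + B * (B * r ^+ (N - `|m|))) * (B * B * B * B * B).
  by rewrite /K; ring.
rewrite ler_pM ?nm_ge0 //.
  by apply: le_trans (nmD _ _) _; rewrite !nmM lerD // ler_pM ?nm_ge0 // b3'.
by rewrite !nmM; do 4?(apply: ler_pM; rewrite ?mulr_ge0 ?nm_ge0 //).
Qed.

Lemma jacobi_termM (m n : int) x y : x != 0 -> y != 0 ->
  jacobi_term m (x * y) * jacobi_term n (x / y) =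
  (-1) ^ (m + n) * p ^ ((tri m)%:Z + (tri n)%:Z) * x ^ (m + n) * y ^ (m - n).
Proof.
move=> x0 y0; rewrite /jacobi_term !expfzDr ?oppr_eq0 ?oner_neq0 // !expfzMl.
by rewrite -exprz_inv -!exprnP; ring.
Qed.

(** The product of two partial products of theta with all coefficients replaced by [qkappa N] and
    with the full box of pairs [(s, t)] for each parity; both changes are needed to factor the
    double sums. *)
Definition rank2_approx N x y : C :=
  \sum_(e <- [:: 0; 1]) \sum_(s <- lattice_range N) \sum_(t <- lattice_range N)
     qkappa N ^+ 2 * (jacobi_term (s + t + e) (x * y) * jacobi_term (s - t) (x / y)).

(** The exponents of [p] add up to s^2 - s + t^2 for e = 0 and s^2 + t^2 + t for e = 1, the sign is
    (-1)^e, and x and y carry powers depending on s and on t alone: each parity gives one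
    product. *)
Lemma rank2_approxE N : exists A0 B0 A1 B1 : C -> C, forall x y, x != 0 -> y != 0 ->
  rank2_approx N x y = A0 x * B0 y - A1 x * B1 y.
Proof.
exists (fun x => qkappa N ^+ 2 * \sum_(s <- lattice_range N) p ^ (s * s - s) * x ^ (s + s)).
exists (fun y => \sum_(t <- lattice_range N) p ^ (t * t) * y ^ (t + t)).
exists (fun x => qkappa N ^+ 2 * \sum_(s <- lattice_range N) p ^ (s * s) * x ^ (s + s + 1)).
exists (fun y => \sum_(t <- lattice_range N) p ^ (t * t + t) * y ^ (t + t + 1)).
move=> x y x0 y0; rewrite /rank2_approx big_cons big_seq1.
have sq (m : int) : (-1) ^ (m + m) = 1 :> C by rewrite expfzDr ?oppr_eq0 ?oner_neq0 // -expfzMl mulrNN mulr1 exp1rz.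
congr (_ + _).
  rewrite -[RHS]mulrA big_distrlr /= mulr_sumr; apply: eq_bigr => s _; rewrite mulr_sumr.
  apply: eq_bigr => t _; rewrite jacobi_termM // addr0.
  have -> : s + t + (s - t) = s + s by lia.
  have -> : s + t - (s - t) = t + t by lia.
  have -> : (tri (s + t))%:Z + (tri (s - t))%:Z = (s * s - s) + t * t.
    by have := tri_mul2 (s + t); have := tri_mul2 (s - t); nia.
  by rewrite sq expfzDr //; ring.
rewrite -[X in _ = - X]mulrA big_distrlr /= -mulrN -sumrN mulr_sumr; apply: eq_bigr => s _.
rewrite -sumrN mulr_sumr.
apply: eq_bigr => t _; rewrite jacobi_termM //.
have -> : s + t + 1 + (s - t) = s + s + 1 by lia.
have -> : s + t + 1 - (s - t) = t + t + 1 by lia.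
have -> : (tri (s + t + 1))%:Z + (tri (s - t))%:Z = s * s + (t * t + t).
  by have := tri_mul2 (s + t + 1); have := tri_mul2 (s - t); nia.
rewrite [(-1) ^ (s + s + 1)]expfzDr ?oppr_eq0 ?oner_neq0 // sq expr1z expfzDr //; ring.
Qed.

Lemma rank2_approx_rate x y : x != 0 -> y != 0 -> exists K : R, forall N,
  nm (thetaN N (x * y) * thetaN N (x / y) - rank2_approx N x y) <= K * ((2 * N).+1%:R ^+ 2 * r ^+ N).
Proof.
move=> x0 y0; have xy0 : x * y != 0 by rewrite mulf_neq0.
have xv0 : x / y != 0 by rewrite mulf_neq0 ?invr_neq0.
have [K1 K10 k1] := jacobi_term_bound xy0; have [K2 K20 k2] := jacobi_term_bound xv0.
have [K K0 [q1 q2 q3]] := qcoef_bound.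
have rX n : 0 <= r ^+ n by rewrite exprn_ge0 // ltW.
have rX1 n : r ^+ n <= 1 by rewrite exprn_ile1 // ltW.
(* The outer 2 counts the parities, the inner one the two coefficients replaced. *)
exists (2 * (2 * (K * K * (K1 * K2)))) => N.
pose F m n := qcoef N m * qcoef N n * (jacobi_term m (x * y) * jacobi_term n (x / y)).
have -> : thetaN N (x * y) * thetaN N (x / y) =
   \sum_(m <- lattice_range N) \sum_(n <- lattice_range N) F m n.
  rewrite !thetaN_laurent // big_distrlr /=; apply: eq_big_seq => m mr; apply: eq_big_seq => n nr.
  by move: mr nr; rewrite !mem_lattice_range /F /qcoef => -> ->; ring.
rewrite lattice_reindex; last first.
  by move=> m n; rewrite /F /qcoef !ltnNge => /orP[] /negbTE ->; rewrite ?mulr0 !mul0r.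
rewrite /rank2_approx -sumrB.
apply: (@le_trans _ _ (\sum_(e <- [:: 0; 1 : int]) \sum_(s <- lattice_range N) \sum_(t <- lattice_range N)
    2 * (K * K * (K1 * K2)) * r ^+ N)); last first.
  have sz : size (lattice_range N) = (2 * N).+1 by rewrite size_map size_iota.
  have cst (c : R) : \sum_(s <- lattice_range N) c = (2 * N).+1%:R * c.
    by rewrite big_const_seq count_predT sz iter_addr_0 mulr_natl.
  move: (2 * (K * K * (K1 * K2))) => c.
  under eq_bigr do rewrite cst cst.
  by rewrite big_cons big_seq1 le_eqVlt; apply/orP; left; apply/eqP; ring.
apply: le_trans (nm_sum _ _ _) _; apply: ler_sum => e _; rewrite -sumrB.
apply: le_trans (nm_sum _ _ _) _; apply: ler_sum => s _; rewrite -sumrB.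
apply: le_trans (nm_sum _ _ _) _; apply: ler_sum => t _.
set m := s + t + e; set n := s - t; rewrite /F -mulrBl nmM [X in _ * X]nmM.
have hT : nm (jacobi_term m (x * y)) * nm (jacobi_term n (x / y)) <= (K1 * r ^+ `|m|) * (K2 * r ^+ `|n|).
  by rewrite ler_pM ?nm_ge0.
have hQ : nm (qcoef N m * qcoef N n - qkappa N ^+ 2) <=
   nm (qcoef N m - qkappa N) * K + K * nm (qcoef N n - qkappa N).
  have -> : qcoef N m * qcoef N n - qkappa N ^+ 2 =
    (qcoef N m - qkappa N) * qcoef N n + qkappa N * (qcoef N n - qkappa N) by ring.
  apply: le_trans (nmD _ _) _; rewrite (nmM (qcoef N m - _)) (nmM (qkappa N)).
  by apply: lerD; apply: ler_pM; rewrite ?nm_ge0 ?q1 ?q2.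
apply: (@le_trans _ _ ((nm (qcoef N m - qkappa N) * K + K * nm (qcoef N n - qkappa N)) *
   ((K1 * r ^+ `|m|) * (K2 * r ^+ `|n|)))).
  by rewrite ler_pM ?mulr_ge0 ?nm_ge0.
have -> : (nm (qcoef N m - qkappa N) * K + K * nm (qcoef N n - qkappa N)) *
   ((K1 * r ^+ `|m|) * (K2 * r ^+ `|n|)) =
   (K * (K1 * K2)) * ((nm (qcoef N m - qkappa N) * r ^+ `|m|) * r ^+ `|n|
     + (nm (qcoef N n - qkappa N) * r ^+ `|n|) * r ^+ `|m|) by ring.
have -> : 2 * (K * K * (K1 * K2)) * r ^+ N = (K * (K1 * K2)) * (K * r ^+ N * 1 + K * r ^+ N * 1) by ring.
apply: ler_wpM2l; first by rewrite !mulr_ge0.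
by rewrite lerD // ler_pM // mulr_ge0 ?nm_ge0.
Qed.

(** With s = r^(1/4), Bernoulli's inequality for 1/s bounds (2N+1) s^N; its square absorbs half of
    the decay. *)
Lemma sqr_geometric_le : exists c s : R, [/\ 0 <= s, s < 1 &
  forall N, (2 * N).+1%:R ^+ 2 * r ^+ N <= c * s ^+ N].
Proof.
pose s := Num.sqrt (Num.sqrt r).
have s0 : 0 < s by rewrite !sqrtr_gt0.
have s4 : s ^+ 4 = r.
  by rewrite (exprM s 2 2) sqr_sqrtr ?sqrtr_ge0 // sqr_sqrtr // ltW.
have s1 : s < 1.
  rewrite ltNge; apply/negP => /(fun h => exprn_ege1 4 h); rewrite s4 leNgt r1 //.
pose h := s^-1 - 1; have h0 : 0 < h by rewrite subr_gt0 invf_gt1.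
have bern N : 1 + N%:R * h <= s^-1 ^+ N.
  elim: N => [|N IH]; first by rewrite mul0r addr0 expr0.
  have hN : 0 <= N%:R * h * h by rewrite !mulr_ge0 // ltW.
  have e : s^-1 = 1 + h by rewrite /h; ring.
  rewrite e in IH *; rewrite exprS (@le_trans _ _ ((1 + h) * (1 + N%:R * h))) //.
    by rewrite -natr1; lra.
  by apply: ler_wpM2l => //; rewrite addr_ge0 // ltW.
pose c := 2 / h + 1.
have lin N : (2 * N).+1%:R * s ^+ N <= c.
  have sN : 0 < s ^+ N by rewrite exprn_gt0.
  have sN1 : s ^+ N <= 1 by rewrite exprn_ile1 // ltW.
  have e : s ^+ N * s^-1 ^+ N = 1 by rewrite exprVn mulfV // gt_eqF.
  have t : N%:R * s ^+ N <= h^-1.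
    have nh : N%:R * h <= s^-1 ^+ N by apply: le_trans _ (bern N); rewrite lerDr ler01.
    rewrite -[leRHS]mul1r ler_pdivlMr // -[leRHS]e [leLHS]mulrAC [leLHS]mulrC.
    by apply: ler_wpM2l => //; exact: ltW.
  rewrite -natr1 natrM mulrDl mul1r -mulrA lerD // ler_wpM2l //.
exists (c ^+ 2), (s ^+ 2); split; [by rewrite exprn_ge0 // ltW| |].
  by rewrite exprn_ilt1 // ltW.
move=> N; rewrite -s4.
have -> : (2 * N).+1%:R ^+ 2 * s ^+ 4 ^+ N = ((2 * N).+1%:R * s ^+ N) ^+ 2 * s ^+ 2 ^+ N.
  rewrite [X in _ = X * _]exprMn -[RHS]mulrA; congr (_ * _).
  by rewrite -!exprM -exprD; congr (s ^+ _); lia.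
apply: ler_wpM2r; first by rewrite !exprn_ge0 // ltW.
by rewrite lerXn2r ?nnegrE ?mulr_ge0 ?exprn_ge0 ?addr_ge0 ?divr_ge0 // ltW.
Qed.

Lemma rank2_approx_cvg x y : x != 0 -> y != 0 ->
  (fun N => rank2_approx N x y) @ \oo --> theta p (x * y) * theta p (x / y).
Proof.
move=> x0 y0; have [K hK] := rank2_approx_rate x0 y0.
have [c [s [s0 s1 hs]]] := sqr_geometric_le.
have K0 : 0 <= K.
  have := hK 0%N; rewrite expr1n expr0 !mulr1; apply: le_trans; exact: nm_ge0.
have d0 : (fun N => thetaN N (x * y) * thetaN N (x / y) - rank2_approx N x y) @ \oo --> (0 : C).
  apply: (cvg_nm0 (v := fun N => K * c * s ^+ N)).
    by move=> N; rewrite subr0 (le_trans (hK N)) // -mulrA ler_wpM2l.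
  rewrite -[X in _ --> X](mulr0 (K * c)); apply: cvgM; first exact: cvg_cst.
  by apply: cvg_expr; rewrite ger0_norm.
have t0 : (fun N => thetaN N (x * y) * thetaN N (x / y)) @ \oo --> theta p (x * y) * theta p (x / y).
  by apply: cvgM; exact: thetaN_cvg.
have -> : (fun N => rank2_approx N x y) =
  (fun N => thetaN N (x * y) * thetaN N (x / y)) -
  (fun N => thetaN N (x * y) * thetaN N (x / y) - rank2_approx N x y).
  by apply: funext => N; rewrite /= opprB addrC subrK.
rewrite -[X in _ --> X]subr0; exact: cvgB.
Qed.

End Weierstrass.

(** * From rank 2 to the addition formula *)

Definition det3 (T : pzRingType) (f : 'I_3 -> 'I_3 -> T) : T :=
  f 0 0 * (f 1 1 * f 2 2 - f 1 2 * f 2 1)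
  - f 0 1 * (f 1 0 * f 2 2 - f 1 2 * f 2 0)
  + f 0 2 * (f 1 0 * f 2 1 - f 1 1 * f 2 0).

(** The determinants of the approximations vanish and converge. For [p = 0], where the Laurent
    expansion would divide by powers of [p], theta(u) = 1 - u and the claim is a rational
    identity. *)
Lemma theta_det3 (x y : 'I_3 -> C) : (forall i, x i != 0) -> (forall i, y i != 0) ->
  det3 (fun i j => theta p (x i * y j) * theta p (x i / y j)) = 0.
Proof.
move=> x0 y0; have [pE|p0] := eqVneq p 0.
  have tE u : theta p u = 1 - u.
    apply: (@cvgn_unique (thetaN^~ u)); first exact: thetaN_cvg.
    apply/nm_cvgP => e e0; exists 1%N => -[//|n] _.
    rewrite /thetaN big_nat_recl // pE expr0 mul1r expr1 mul0r subr0 mulr1 big1 ?mulr1 ?subrr ?nm0 //.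
    by move=> j _; rewrite !exprS !mul0r !subr0 mulr1.
  by rewrite /det3 !tE; field; rewrite !y0.
pose h N i j := rank2_approx N (x i) (y j).
have h0 N : det3 (h N) = 0.
  have [A0 [B0 [A1 [B1 E]]]] := rank2_approxE p0 N.
  by rewrite /det3 /h !E //; ring.
apply: (@cvgn_unique (fun N => det3 (h N))); last first.
  by under eq_fun do rewrite h0; exact: cvg_cst.
have hc i j : (fun N => h N i j) @ \oo --> theta p (x i * y j) * theta p (x i / y j).
  exact: rank2_approx_cvg.
have minor i j k l : (fun N => h N 1 i * h N 2 j - h N 1 k * h N 2 l) @ \oo -->
    theta p (x 1 * y i) * theta p (x 1 / y i) * (theta p (x 2 * y j) * theta p (x 2 / y j)) -
    theta p (x 1 * y k) * theta p (x 1 / y k) * (theta p (x 2 * y l) * theta p (x 2 / y l)).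
  by apply: cvgB; (apply: cvgM; exact: hc).
rewrite /det3; apply: cvgD; last by apply: cvgM; [exact: hc | exact: minor].
by apply: cvgB; (apply: cvgM; [exact: hc | exact: minor]).
Qed.

Definition thetaG (x y : C) : C := theta p (x * y) * theta p (x / y) / x.

Lemma thetaG_anti x y : x != 0 -> y != 0 -> thetaG y x = - thetaG x y.
Proof.
move=> x0 y0; rewrite /thetaG -[y / x]invrK theta_inv ?invr_eq0 ?mulf_neq0 ?invr_eq0 //.
by rewrite invf_div [y * x]mulrC; field; rewrite x0 y0.
Qed.

Lemma thetaGxx x : x != 0 -> thetaG x x = 0.
Proof. by move=> x0; rewrite /thetaG divff // theta1 mulr0 mul0r. Qed.

(* The minor with rows [x], [y], [u] and columns [x], [y], [v]. *)
Lemma thetaG_pfaffian_mul x y u v : x != 0 -> y != 0 -> u != 0 -> v != 0 ->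
  thetaG x y * (thetaG x y * thetaG u v - thetaG x u * thetaG y v + thetaG x v * thetaG y u) = 0.
Proof.
move=> x0 y0 u0 v0.
pose xs (i : 'I_3) := if i == 0 then x else if i == 1 then y else u.
pose ys (i : 'I_3) := if i == 0 then x else if i == 1 then y else v.
have xs0 i : xs i != 0 by rewrite /xs; do 2?case: ifP.
have ys0 i : ys i != 0 by rewrite /ys; do 2?case: ifP.
have := theta_det3 xs0 ys0.
have [X0 X1 X2] : [/\ xs 0 = x, xs 1 = y & xs 2 = u] by [].
have [Y0 Y1 Y2] : [/\ ys 0 = x, ys 1 = y & ys 2 = v] by [].
have gE a b : a != 0 -> theta p (a * b) * theta p (a / b) = a * thetaG a b.
  by move=> a0; rewrite /thetaG; field.
rewrite /det3 X0 X1 X2 Y0 Y1 Y2 !gE // !thetaGxx //.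
rewrite (thetaG_anti x0 y0) (thetaG_anti x0 u0) (thetaG_anti y0 u0) => h.
have xyu : x * y * u != 0 by rewrite !mulf_neq0.
by apply: (mulfI xyu); rewrite mulr0 -h; ring.
Qed.

(** Up to sign the Pfaffian is invariant under permutations. If it were nonzero,
    [thetaG_pfaffian_mul] would make [thetaG x y], [thetaG x u] and [thetaG x v] vanish, and with
    them each of its terms. *)
Lemma thetaG_pfaffian x y u v : x != 0 -> y != 0 -> u != 0 -> v != 0 ->
  thetaG x y * thetaG u v - thetaG x u * thetaG y v + thetaG x v * thetaG y u = 0.
Proof.
move=> x0 y0 u0 v0; set P := (X in X = 0).
have [//|P0] := eqVneq P 0.
have e1 : thetaG x y = 0.
  by have /eqP := thetaG_pfaffian_mul x0 y0 u0 v0; rewrite -/P mulf_eq0 (negbTE P0) orbF => /eqP.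
have e2 : thetaG x u = 0.
  have := thetaG_pfaffian_mul x0 u0 y0 v0.
  rewrite (thetaG_anti y0 u0) => h; apply/eqP; move/eqP: h.
  have -> : thetaG x u * thetaG y v - thetaG x y * thetaG u v + thetaG x v * - thetaG y u = - P.
    by rewrite /P; ring.
  by rewrite mulf_eq0 oppr_eq0 (negbTE P0) orbF.
have e3 : thetaG x v = 0.
  have := thetaG_pfaffian_mul x0 v0 y0 u0.
  rewrite (thetaG_anti y0 v0) (thetaG_anti u0 v0) => h; apply/eqP; move/eqP: h.
  have -> : thetaG x v * thetaG y u - thetaG x y * - thetaG u v + thetaG x u * - thetaG y v = P.
    by rewrite /P; ring.
  by rewrite mulf_eq0 (negbTE P0) orbF.
by rewrite /P e1 e2 e3 !mul0r subrr addr0.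
Qed.

(** Dividing by a square root s of l turns a -> l/a into a/s -> s/a; the formula is the Pfaffian
    relation at us, x/s, y/s, v/s. *)
Lemma theta_three_term l u x y v : l != 0 -> u != 0 -> x != 0 -> y != 0 -> v != 0 ->
  theta p (u * x) * theta p (u * l / x) * (theta p (y / v) * theta p (y * v / l) / y)
  = theta p (u * y) * theta p (u * l / y) * (theta p (x / v) * theta p (x * v / l) / x)
  - theta p (u * v) * theta p (u * l / v) * (theta p (x / y) * theta p (x * y / l) / x).
Proof.
move=> l0 u0 x0 y0 v0; pose s := sqrtC l.
have s0 : s != 0 by rewrite sqrtC_eq0.
have lE : l = s * s by rewrite -expr2 sqrtCK.
have E1 a : a != 0 -> theta p (u * a) * theta p (u * l / a) = u * s * thetaG (u * s) (a / s).
  move=> a0; rewrite /thetaG [u * s * _]mulrC divfK ?mulf_neq0 // lE.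
  by congr (theta p _ * theta p _); field; rewrite ?s0 ?a0.
have E2 a b : a != 0 -> theta p (a / b) * theta p (a * b / l) / a = thetaG (a / s) (b / s) / s.
  move=> a0; have [->|b0] := eqVneq b 0.
    rewrite /thetaG !mul0r !mulr0 !invr0 !mulr0 mul0r; by field; rewrite a0 s0.
  rewrite /thetaG lE.
  have -> : a / s * (b / s) = a * b / (s * s) by field; rewrite s0.
  have -> : a / s / (b / s) = a / b by field; rewrite s0 b0.
  by field; rewrite a0 s0.
rewrite (E1 x x0) (E1 y y0) (E1 v v0) (E2 y v y0) (E2 x v x0) (E2 x y x0).
have us : u * s != 0 by rewrite mulf_neq0.
have ds a : a != 0 -> a / s != 0 by move=> a0; rewrite mulf_neq0 ?invr_neq0.
have P := thetaG_pfaffian us (ds _ x0) (ds _ y0) (ds _ v0).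
apply/eqP; rewrite -subr_eq0; apply/eqP.
transitivity (u * s / s * (thetaG (u * s) (x / s) * thetaG (y / s) (v / s)
  - thetaG (u * s) (y / s) * thetaG (x / s) (v / s) + thetaG (u * s) (v / s) * thetaG (x / s) (y / s))).
  ring.
by rewrite P mulr0.
Qed.

End Theta.
End Analysis.

(** * Removing genericity *)

Section Perturbation.
Variables (C : numClosedFieldType) (p q : C).
Hypothesis q0 : q != 0.
Local Notation th := (theta p).
Hypothesis thV : forall x : C, x != 0 -> th x^-1 = - th x / x.
Hypothesis th1 : th 1 = 0.
Hypothesis three_term : forall l u x y v : C, l != 0 -> u != 0 -> x != 0 -> y != 0 -> v != 0 ->
  th (u * x) * th (u * l / x) * (th (y / v) * th (y * v / l) / y)
  = th (u * y) * th (u * l / y) * (th (x / v) * th (x * v / l) / x)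
  - th (u * v) * th (u * l / v) * (th (x / y) * th (x * y / l) / x).
Hypothesis th_cvg : forall (u : nat -> C) (x : C), x != 0 -> u @ \oo --> x ->
  (fun k => th (u k)) @ \oo --> th x.
Hypothesis th_isolated : forall (u : nat -> C) (x : C), x != 0 -> u @ \oo --> x ->
  (forall k, u k != x) -> exists n0, forall k, (n0 <= k)%N -> th (u k) != 0.
(* [t1] also gives [t k != 1], needed to leave the zeros of [th]. *)
Variable t : nat -> C.
Hypothesis t_cvg : t @ \oo --> (1 : C).
Hypothesis t0 : forall k, t k != 0.
Hypothesis t1 : forall k, t k ^+ 2 != 1.

Local Notation pc := (poch th q).

Lemma t_neq1 k : t k != 1.
Proof. by apply: contraNneq (t1 k) => ->; rewrite expr1n. Qed.

Lemma cvgn_cst (x : C) : (fun _ : nat => x) @ \oo --> x.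
Proof. exact: cvg_cst. Qed.

Lemma cvgn_mul (u v : nat -> C) (x y : C) : u @ \oo --> x -> v @ \oo --> y ->
  (fun k => u k * v k) @ \oo --> x * y.
Proof. exact: cvgM. Qed.

Lemma cvgn_div (u v : nat -> C) (x y : C) : y != 0 -> u @ \oo --> x -> v @ \oo --> y ->
  (fun k => u k / v k) @ \oo --> x / y.
Proof. by move=> y0 ux vy; apply: cvgM => //; exact: cvgV. Qed.

Lemma cvgn_scale (x : C) : (fun k => x * t k) @ \oo --> x.
Proof. by rewrite -[X in _ --> X]mulr1; apply: cvgn_mul => //; exact: cvgn_cst. Qed.

Lemma cvgn_scale2 (x : C) : (fun k => x * t k ^+ 2) @ \oo --> x.
Proof.
have e : x * (1 * 1) = x by rewrite !mulr1.
rewrite -[X in _ --> X]e; apply: cvgn_mul; first exact: cvgn_cst.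
exact: cvgn_mul.
Qed.

Lemma poch_cvg (u : nat -> C) (x : C) k : x != 0 -> u @ \oo --> x ->
  (fun i => pc (u i) k) @ \oo --> pc x k.
Proof.
move=> x0 ux; apply: cvgn_prod => j _; apply: th_cvg; first by rewrite mulf_neq0 // expf_neq0.
by apply: cvgn_mul => //; exact: cvgn_cst.
Qed.

Lemma eventually_forall (I : finType) (P : I -> nat -> Prop) :
  (forall i, exists n0, forall k, (n0 <= k)%N -> P i k) ->
  exists n0, forall k, (n0 <= k)%N -> forall i, P i k.
Proof.
move=> h; have [f hf] := choice h.
by exists (\max_i f i) => k hk i; apply: hf; apply: leq_trans hk; exact: leq_bigmax.
Qed.

Variable n : nat.
Implicit Types (z : 'I_n -> C) (m y : 'I_n -> nat).

Definition scale z k : 'I_n -> C := fun i => z i * t k.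

Lemma scale_cvg z i : (fun k => scale z k i) @ \oo --> z i.
Proof. exact: cvgn_scale. Qed.

Lemma scale_cvgM (x : C) z i : (fun k => x * scale z k i) @ \oo --> x * z i.
Proof. by apply: cvgn_mul; [exact: cvgn_cst | exact: scale_cvg]. Qed.

Lemma scale_cvg_ratio (x : C) z i j : zpos z ->
  (fun k => x * scale z k i / scale z k j) @ \oo --> x * z i / z j.
Proof.
by move=> z0; apply: cvgn_div; [exact: z0 | exact: scale_cvgM | exact: scale_cvg].
Qed.

(** Each of the finitely many arguments is [x * t k] or [x * t k ^+ 2] with [x != 0]; it tends to
    [x] without reaching it, and zeros of theta are isolated. *)
Lemma generic_eventually (a l : C) z m : a != 0 -> l != 0 -> zpos z ->
  exists n0, forall k, (n0 <= k)%N -> generic th q a l (scale z k) m.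
Proof.
move=> a0 l0 z0; set M := (\sum_(k < n) m k)%N.
have iso1 (x : C) : x != 0 -> exists n0, forall k, (n0 <= k)%N -> th (x * t k) != 0.
  move=> x0; apply: (@th_isolated (fun k => x * t k) x) => [//||k]; first exact: cvgn_scale.
  by rewrite -subr_eq0 -[X in _ - X]mulr1 -mulrBr mulf_neq0 // subr_eq0 t_neq1.
have iso2 (x : C) : x != 0 -> exists n0, forall k, (n0 <= k)%N -> th (x * t k ^+ 2) != 0.
  move=> x0; apply: (@th_isolated (fun k => x * t k ^+ 2) x) => [//||k]; first exact: cvgn_scale2.
  by rewrite -subr_eq0 -[X in _ - X]mulr1 -mulrBr mulf_neq0 // subr_eq0 t1.
have qX i : q ^+ i != 0 by rewrite expf_neq0.
have h1 (x : 'I_n * 'I_(3 * M).+1) : exists n0, forall k, (n0 <= k)%N -> th (a * z x.1 * q ^+ x.2 * t k) != 0.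
  by apply: iso1; rewrite !mulf_neq0.
have h2 (x : 'I_n * 'I_(3 * M).+1) : exists n0, forall k, (n0 <= k)%N -> th (a * z x.1 * q ^+ x.2 / l * t k) != 0.
  by apply: iso1; rewrite !mulf_neq0 ?invr_neq0.
have h3 (x : 'I_n * 'I_n * 'I_(3 * M).+1) : exists n0, forall k, (n0 <= k)%N ->
    th (a ^+ 2 * z x.1.1 * z x.1.2 * q ^+ x.2 / l * t k ^+ 2) != 0.
  by apply: iso2; rewrite !mulf_neq0 ?invr_neq0 ?expf_neq0.
have [n1 {}h1] := eventually_forall h1; have [n2 {}h2] := eventually_forall h2.
have [n3 {}h3] := eventually_forall h3.
exists (maxn n1 (maxn n2 n3)) => k; rewrite !geq_max => /and3P[/h1 {}h1 /h2 {}h2 /h3 {}h3].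
split=> [j i|j i|j j' i]; rewrite -/M -ltnS => ilt; rewrite /scale.
- have := h1 (j, Ordinal ilt); congr (th _ != 0); rewrite /=; ring.
- have := h2 (j, Ordinal ilt); congr (th _ != 0); rewrite /=; ring.
- have := h3 (j, j', Ordinal ilt); congr (th _ != 0); rewrite /=; ring.
Qed.

Lemma separated_scale z m k : separated th q z m -> separated th q (scale z k) m.
Proof.
move=> sz l j i i' il ij ne; have := sz l j i i' il ij ne; congr (th _ != 0).
by rewrite /scale !mulrA -[RHS]mulf_div divff // mulr1.
Qed.

(** Denominators involving [z] are nonzero in the limit by hypothesis; the others do not depend on
    [k]. *)
Lemma cleared_term_cvg (a b c d e : C) z m y :
  a != 0 -> b != 0 -> c != 0 -> d != 0 -> e != 0 -> zpos z ->
  vdm th z != 0 -> (forall k, th (a * z k) != 0) ->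
  (forall j, pc (a * q ^+ (1 + m j) * z j) (\sum_(k < n) y k) != 0) ->
  (forall j k, pc (q * z k / z j) (y k) != 0) ->
  (fun k => cleared_term th q a b c d e (scale z k) m y) @ \oo --> cleared_term th q a b c d e z m y.
Proof.
move=> a0 b0 c0 d0 e0 z0 vz ha hm hq.
have qX i : q ^+ i != 0 by rewrite expf_neq0.
have vdm_cvg y' : (fun k => vdm th (qshift q (scale z k) y')) @ \oo --> vdm th (qshift q z y').
  apply: cvgn_prod => j _; apply: cvgn_prod => l _.
  have h i : (fun k => qshift q (scale z k) y' i) @ \oo --> qshift q z y' i.
    by apply: cvgn_mul; [exact: scale_cvg | exact: cvgn_cst].
  have h0 i : qshift q z y' i != 0 by rewrite mulf_neq0.
  apply: cvgn_mul => //; apply: th_cvg; first by rewrite mulf_neq0 ?invr_neq0.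
  exact: cvgn_div.
have vdm_cvg0 : (fun k => vdm th (scale z k)) @ \oo --> vdm th z.
  have E z' : z' = qshift q z' (fun=> 0%N) by apply: funext => i; rewrite /qshift mulr1.
  rewrite [X in _ --> vdm th X]E; under eq_fun do rewrite [scale z _]E; exact: vdm_cvg.
have pcs (x : C) i j : x != 0 -> (fun k => pc (x * scale z k i) j) @ \oo --> pc (x * z i) j.
  by move=> x0; apply: poch_cvg; [rewrite mulf_neq0 | exact: scale_cvgM].
have pcq (x f : C) i j r : x != 0 -> f != 0 ->
    (fun k => pc (x * scale z k i / f * q ^+ j) r) @ \oo --> pc (x * z i / f * q ^+ j) r.
  move=> x0 f0; apply: poch_cvg; first by rewrite !mulf_neq0 ?invr_neq0.
  apply: cvgn_mul; last exact: cvgn_cst.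
  by apply: cvgn_mul; [exact: scale_cvgM | exact: cvgn_cst].
have pcr (x : C) i l j : x != 0 ->
    (fun k => pc (x * scale z k i / scale z k l) j) @ \oo --> pc (x * z i / z l) j.
  move=> x0; apply: poch_cvg; first by rewrite !mulf_neq0 ?invr_neq0.
  exact: scale_cvg_ratio.
have ths i j : (fun k => th (a * scale z k i * q ^+ j)) @ \oo --> th (a * z i * q ^+ j).
  apply: th_cvg; first by rewrite !mulf_neq0.
  by apply: cvgn_mul; [exact: scale_cvgM | exact: cvgn_cst].
have th0s i : (fun k => th (a * scale z k i)) @ \oo --> th (a * z i).
  by apply: th_cvg; [rewrite mulf_neq0 | exact: scale_cvgM].
apply: cvgn_mul; last first.
  apply: cvgn_div.
  - by apply/prodf_neq0 => j _; apply/prodf_neq0 => k _; exact: hq.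
  - by apply: cvgn_prod => k _; apply: pcq => //; rewrite mulf_neq0.
  by apply: cvgn_prod => j _; apply: cvgn_prod => k _; exact: pcr.
apply: cvgn_mul; last first.
  by apply: cvgn_prod => j _; apply: cvgn_prod => k _; apply: pcr; rewrite invr_neq0.
apply: cvgn_mul; last first.
  by apply: cvgn_prod => k _; apply: pcq => //; rewrite mulf_neq0.
apply: cvgn_mul; last first.
  by apply: cvgn_prod => k _; apply: cvgn_mul; exact: pcs.
apply: cvgn_mul; last exact: cvgn_cst.
apply: cvgn_mul; last exact: cvgn_cst.
apply: cvgn_mul; last first.
  apply: cvgn_mul; first exact: cvgn_cst.
  apply: cvgn_prod => j _; apply: cvgn_div => //; apply: pcs => //.
  by rewrite mulf_neq0.
apply: cvgn_mul; last by apply: cvgn_prod => k _; apply: cvgn_div.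
exact: cvgn_div.
Qed.

Lemma cleared_rhs_cvg (a b c d : C) z m : a != 0 -> b != 0 -> c != 0 -> zpos z ->
  (fun k => cleared_rhs th q a b c d (scale z k) m) @ \oo --> cleared_rhs th q a b c d z m.
Proof.
move=> a0 b0 c0 z0; apply: cvgn_mul; first exact: cvgn_cst.
apply: cvgn_prod => k _; apply: cvgn_mul; apply: poch_cvg; rewrite ?mulf_neq0 ?invr_neq0 ?mulf_neq0 //.
  exact: scale_cvgM.
by apply: cvgn_mul; [exact: scale_cvgM | exact: cvgn_cst].
Qed.

(** Both sides converge along [scale z k] and agree from some [k] on. *)
Lemma cleared_sumE (a b c d e : C) z m N : (forall k, (m k < N)%N) -> (0 < N)%N ->
  let M := (\sum_(k < n) m k)%N in
  a != 0 -> b != 0 -> c != 0 -> d != 0 -> e != 0 -> zpos z ->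
  a ^+ 2 * q ^+ (1 + M) = b * c * d * e ->
  separated th q z m -> (forall k, th (a * z k) != 0) ->
  pc (a * q / d) M != 0 -> pc (a * q / e) M != 0 ->
  (forall j i, (i <= M)%N -> pc (a * q ^+ (1 + m j) * z j) i != 0) ->
  cleared_sum th q N a b c d e z m = cleared_rhs th q a b c d z m.
Proof.
move=> mN N0 M a0 b0 c0 d0 e0 z0 bal sz ha hd he hm.
have [n0 hn] := generic_eventually m a0 (mulf_neq0 b0 c0) z0.
have L : (fun k => cleared_sum th q N a b c d e (scale z k) m) @ \oo --> cleared_sum th q N a b c d e z m.
  apply: cvgn_sum => y /forallP ym; apply: cleared_term_cvg => //.
  - exact: separated_vdm sz z0.
  - by move=> j; apply: hm; apply: leq_sum => k _; exact: ym.
  - by move=> j k; apply: (separated_pc q0 j sz z0); exact: ym.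
have pcP x k : pc x k != 0 -> forall i, (i < k)%N -> th (x * q ^+ i) != 0.
  by rewrite /poch prodf_seq_neq0 => /allP h i ik; apply: h; rewrite mem_index_iota.
have L2 : (fun k => cleared_rhs th q a b c d (scale z k) m) @ \oo --> cleared_rhs th q a b c d z m.
  exact: cleared_rhs_cvg.
suff L3 : (fun k => cleared_sum th q N a b c d e (scale z k) m) @ \oo --> cleared_rhs th q a b c d z m.
  by apply: (cvg_unique (@norm_hausdorff _ _) L L3).
apply: (cvg_trans _ L2).
apply: near_eq_cvg; exists n0 => // k /= /hn g; symmetry.
apply: (@cleared_sum_generic _ th q q0 thV th1 three_term n N M) => //.
- by move=> i; rewrite mulf_neq0.
- exact: separated_scale.
- exact: pcP.
- exact: pcP.
Qed.

Lemma epochs2 (x y : C) k : epochs p q [:: x; y] k = pc x k * pc y k.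
Proof. by rewrite /epochs big_cons big_seq1. Qed.

Lemma poch_last_neq0 (x : C) i : pc x i.+1 != 0 -> th (x * q ^+ i) != 0.
Proof. by rewrite pochSr mulf_eq0 negb_or => /andP[]. Qed.

(** For i > i' the quotient is the last argument in a symbol with base [q * z l / z j]; for i = i'
    it occurs in the Vandermonde product. The remaining cases follow by inversion. *)
Lemma separatedP z m : zpos z -> vdm th z != 0 ->
  (forall j k i, (i <= m k)%N -> pc (q * z k / z j) i != 0) -> separated th q z m.
Proof.
move=> z0 vz hq.
have qX i : q ^+ i != 0 by rewrite expf_neq0.
have lt_case l j i i' : (i <= m l)%N -> (i' < i)%N -> th (q ^+ i * z l / (q ^+ i' * z j)) != 0.
  move=> il ii; have il' : ((i - i'.+1).+1 <= m l)%N by rewrite subnSK // (leq_trans (leq_subr _ _)).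
  have := poch_last_neq0 (hq j l _ il'); congr (th _ != 0).
  have -> : q ^+ i = q * q ^+ (i - i'.+1) * q ^+ i'.
    by rewrite -exprS -exprD; congr (q ^+ _); rewrite subnSK // subnK // ltnW.
  by move: (q ^+ i') (qX i') (q ^+ (i - _)) => Q Q0 Q'; field; rewrite Q0 z0.
have flip (x y : C) : x != 0 -> y != 0 -> th (x / y) != 0 -> th (y / x) != 0.
  by move=> x0 y0 h; rewrite -invf_div thV_neq0 // mulf_neq0 ?invr_neq0.
have diag (l j : 'I_n) : (j < l)%N -> th (z l / z j) != 0.
  move=> jl; apply: contraNneq vz => E; rewrite /vdm (bigD1 j) //= (bigD1 l) //= E.
  by rewrite mulr0 !mul0r.
move=> l j i i' il ij ne.
case: (ltngtP i i') => ii.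
- by apply: flip; rewrite ?mulf_neq0 //; exact: lt_case.
- exact: lt_case.
rewrite ii in ne *; have -> : q ^+ i' * z l / (q ^+ i' * z j) = z l / z j.
  by move: (q ^+ i') (qX i') => Q Q0; field; rewrite Q0 z0.
move: ne; rewrite xpair_eqE eqxx andbT neq_ltn => /orP[lj|jl]; last exact: diag.
by apply: flip => //; exact: diag.
Qed.

(** Passes from the dependent ranges of the theorem to the fixed index type of the induction. *)
Lemma sum_dffun (m : 'I_n -> nat) (f : ('I_n -> nat) -> C) N : (forall k, (m k < N.+1)%N) ->
  \sum_(y : {dffun forall k : 'I_n, 'I_(m k).+1}) f (fun k => y k : nat) =
  \sum_(y : {ffun 'I_n -> 'I_N.+1} | below m y) f (fun k => y k : nat).
Proof.
move=> mN.
pose up (y : {dffun forall k : 'I_n, 'I_(m k).+1}) : {ffun 'I_n -> 'I_N.+1} := [ffun k => inord (y k)].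
pose dn (y : {ffun 'I_n -> 'I_N.+1}) : {dffun forall k : 'I_n, 'I_(m k).+1} := [ffun k => inord (y k)].
have upE (y : {dffun forall k : 'I_n, 'I_(m k).+1}) k : up y k = y k :> nat.
  by rewrite ffunE inordK // (leq_trans (ltn_ord _)).
have upb (y : {dffun forall k : 'I_n, 'I_(m k).+1}) : below m (up y) by apply/forallP => k; rewrite upE -ltnS.
rewrite [RHS](reindex_onto up dn) /=; last first.
  move=> y /forallP ym; apply/ffunP => k; apply: val_inj.
  by rewrite /= upE ffunE inordK // ltnS.
apply: eq_big => [y|y _]; last by congr f; apply: funext => k; rewrite upE.
rewrite upb; symmetry; apply/eqP/ffunP => k; apply: val_inj.
by rewrite ffunE /= inordK upE.
Qed.

Lemma jackson_sum (m : 'I_n -> nat) (a b c d e : C) (z : 'I_n -> C)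
    (ha : a != 0) (hb : b != 0) (hc : c != 0) (hd : d != 0) (he : e != 0)
    (hz : forall k, z k != 0)
    (hbal : a ^+ 2 * q ^+ (1 + \sum_(k < n) m k) = b * c * d * e)
    (hDelta : evandermonde p z != 0)
    (htheta : forall k, theta p (a * z k) != 0)
    (hde : forall i, (i <= \sum_(k < n) m k)%N ->
       epochs p q [:: a * q / d; a * q / e] i != 0)
    (haq : forall j i, (i <= \sum_(k < n) m k)%N ->
       epoch p q (a * q ^+ (1 + m j) * z j) i != 0)
    (hbc : forall k i, (i <= m k)%N ->
       epochs p q [:: a * q * z k / b; a * q * z k / c] i != 0)
    (hqz : forall j k i, (i <= m k)%N -> epoch p q (q * z k / z j) i != 0) :
  \sum_(y : {dffun forall k : 'I_n, 'I_(m k).+1})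
    (let w := (\sum_(k < n) y k)%N in
     evandermonde p (fun k => z k * q ^+ y k) / evandermonde p z
     * (\prod_(k < n) (theta p (a * z k * q ^+ (y k + w)) / theta p (a * z k)))
     * (epochs p q [:: b; c] w / epochs p q [:: a * q / d; a * q / e] w)
     * (\prod_(j < n)
          (epoch p q (a * z j) w / epoch p q (a * q ^+ (1 + m j) * z j) w))
     * q ^+ w
     * (\prod_(k < n)
          (epochs p q [:: d * z k; e * z k] (y k)
           / epochs p q [:: a * q * z k / b; a * q * z k / c] (y k)))
     * (\prod_(j < n) \prod_(k < n)
          (epoch p q (q ^- m j * z k / z j) (y k)
           / epoch p q (q * z k / z j) (y k))))
  = epochs p q [:: a * q / (c * d); a * q / (b * d)] (\sum_(k < n) m k)
    / epochs p q [:: a * q / d; a * q / (b * c * d)] (\sum_(k < n) m k)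
    * \prod_(k < n)
        (epochs p q [:: a * q * z k; a * q * z k / (b * c)] (m k)
         / epochs p q [:: a * q * z k / b; a * q * z k / c] (m k)).
Proof.
set M := (\sum_(k < n) m k)%N.
have mM k : (m k < M.+1)%N by rewrite ltnS /M (bigD1 k) //= leq_addr.
have := hde M (leqnn _); rewrite epochs2 mulf_eq0 negb_or => /andP[pd pe].
have sz : separated th q z m by exact: separatedP.
have main := cleared_sumE mM (ltn0Sn M) ha hb hc hd he hz hbal sz htheta pd pe haq.
(* The factor by which both sides were multiplied; it is nonzero by [hbc] at [i = m k]. *)
pose D := \prod_(k < n) (pc (a * q * z k / b) (m k) * pc (a * q * z k / c) (m k)).
have pbc k : pc (a * q * z k / b) (m k) * pc (a * q * z k / c) (m k) != 0.
  by rewrite -epochs2 hbc.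
have -> : epochs p q [:: a * q / (c * d); a * q / (b * d)] M
    / epochs p q [:: a * q / d; a * q / (b * c * d)] M
    * \prod_(k < n)
        (epochs p q [:: a * q * z k; a * q * z k / (b * c)] (m k)
         / epochs p q [:: a * q * z k / b; a * q * z k / c] (m k))
   = cleared_rhs th q a b c d z m / D.
  rewrite !epochs2 /cleared_rhs -/M /D -[RHS]mulrA -prodf_div; congr (_ * _).
  by apply: eq_bigr => k _; rewrite !epochs2.
rewrite -main /cleared_sum mulr_suml -(sum_dffun (fun y => cleared_term th q a b c d e z m y / D)) //.
apply: eq_bigr => y _; rewrite /cleared_term; set w := (\sum_(k < n) y k)%N.
rewrite /= -/w !epochs2.
have E : \prod_(k < n) (epochs p q [:: d * z k; e * z k] (y k)
           / epochs p q [:: a * q * z k / b; a * q * z k / c] (y k)) =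
   \prod_(k < n) (pc (d * z k) (y k) * pc (e * z k) (y k)) *
   \prod_(k < n) pc (a * q * z k / b * q ^+ y k) (m k - y k) *
   \prod_(k < n) pc (a * q * z k / c * q ^+ y k) (m k - y k) / D.
  rewrite /D -!big_split -prodf_div /=; apply: eq_bigr => k _; rewrite !epochs2.
  have ym : (y k <= m k)%N by rewrite -ltnS.
  have sp X : pc X (m k) = pc X (y k) * pc (X * q ^+ y k) (m k - y k).
    by rewrite -pochD subnKC.
  have := pbc k; rewrite !sp !mulf_eq0 !negb_or.
  by move=> /andP[/andP[h1 h2] /andP[h3 h4]]; field; rewrite h1 h2 h3 h4.
rewrite E.
have -> : \prod_(j < n) \prod_(k < n)
          (epoch p q (q ^- m j * z k / z j) (y k) / epoch p q (q * z k / z j) (y k)) =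
   (\prod_(j < n) \prod_(k < n) pc (q ^- m j * z k / z j) (y k)) /
   \prod_(j < n) \prod_(k < n) pc (q * z k / z j) (y k).
  by rewrite -prodf_div; apply: eq_bigr => j _; rewrite -prodf_div.
have -> : evandermonde p (fun k => z k * q ^+ y k) = vdm th (qshift q z (fun k => y k : nat)) by [].
have -> : evandermonde p z = vdm th z by [].
have -> : \prod_(j < n) (epoch p q (a * z j) w / epoch p q (a * q ^+ (1 + m j) * z j) w) =
   \prod_(j < n) (pc (a * z j) w / pc (a * q ^+ (1 + m j) * z j) w) by [].
by move: D {E} => D; ring.
Qed.
End Perturbation.

Local Open Scope complex_scope.
(** * The complex numbers *)

Import ComplexField.Normc.

Definition Cx (R : realType) : numClosedFieldType := R[i].

Section Norm.
Variable R : realType.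
Implicit Types (x y : R[i]) (u : nat -> Cx R).

Lemma normE x : `|x| = (normc x)%:C. Proof. by []. Qed.

Lemma normc_ge0 x : 0 <= normc x.
Proof. by case: x => a b; exact: sqrtr_ge0. Qed.

Lemma normc_eq0 x : (normc x == 0) = (x == 0).
Proof.
apply/eqP/eqP => [|->]; [exact: eq0_normc | exact: normc0].
Qed.

Lemma normcD x y : normc (x + y) <= normc x + normc y.
Proof. exact: le_normcD. Qed.

Lemma normcNE x : normc (- x) = normc x.
Proof. exact: normcN. Qed.

Lemma normcB x y : normc (x - y) = normc (y - x).
Proof. by rewrite -normcNE opprB. Qed.

Lemma cvg_normcP u (l : Cx R) :
  u @ \oo --> l <-> forall e : R, 0 < e -> exists n0, forall n, (n0 <= n)%N -> normc (u n - l) < e.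
Proof.
split.
  move=> /cvgrPdist_lt h e e0.
  have : 0 < e%:C :> Cx R by rewrite ltcR.
  move=> /h [n0 _ hn]; exists n0 => n nn; have := hn n nn.
  by rewrite /= normE ltcR normcB.
(* A positive element of [R[i]] is real, so a real epsilon suffices. *)
move=> h; apply/cvgrPdist_lt => e; rewrite ltcE => /andP[/eqP /= ei er].
have [n0 hn] := h _ er; exists n0 => // n nn /=.
by rewrite normE ltcE /= ei eqxx normcB; exact: hn.
Qed.

Lemma normc_Re x : `|complex.Re x| <= normc x.
Proof. by have := normc_ge_Re x; rewrite normE lecR. Qed.

Lemma normc_Im x : `|complex.Im x| <= normc x.
Proof.
case: x => a b /=; rewrite -sqrtr_sqr ler_sqrt ?sqr_ge0 //; last by rewrite addr_ge0 ?sqr_ge0.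
by rewrite lerDr sqr_ge0.
Qed.

Lemma normc_le_sum (a b : R) : normc (a +i* b) <= `|a| + `|b|.
Proof.
rewrite /= -[leRHS]ger0_norm ?addr_ge0 // -sqrtr_sqr ler_sqrt ?sqr_ge0 //.
rewrite sqrrD !real_normK ?num_real //; have : 0 <= `|a| * `|b| by rewrite mulr_ge0.
by lra.
Qed.

(* A sequence with geometrically small increments converges: apply completeness
   of [R] to real and imaginary parts, [R[i]] having no [completeType] instance. *)
Lemma geometric_cvg u (C r : R) : 0 <= r -> r < 1 ->
  (forall N k, normc (u (N + k)%N - u N) <= C * r ^+ N) ->
  exists2 l, u @ \oo --> l & forall N, normc (u N - l) <= C * r ^+ N.
Proof.
move=> r0 r1 h.
have C0 : 0 <= C by have := h 0%N 0%N; rewrite expr0 mulr1; apply: le_trans; exact: normc_ge0.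
have g0 : (fun N => C * r ^+ N) @ \oo --> (0 : R).
  by rewrite -[X in _ --> X](mulr0 C); apply: cvgMr; apply: cvg_expr; rewrite ger0_norm.
have cau (f : R[i] -> R) : (forall x y, `|f x - f y| <= normc (x - y)) -> cvgn (f \o u).
  move=> fh; apply: cauchy_cvg; apply: cauchy_exP => e e0.
  have /cvgrPdist_lt /(_ _ e0) [n0 _ hn] := g0.
  exists (f (u n0)); exists n0 => // n /= nn; rewrite /ball /= distrC.
  apply: le_lt_trans (fh _ _) _; rewrite -(subnKC nn); apply: le_lt_trans (h _ _) _.
  by have := hn n0 (leqnn _); rewrite /= sub0r normrN => /(le_lt_trans (ler_norm _)).
have cRe : cvgn (@complex.Re R \o u).
  by apply: cau => x y; apply: le_trans (normc_Re (x - y)); case: x => ? ?; case: y.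
have cIm : cvgn (@complex.Im R \o u).
  by apply: cau => x y; apply: le_trans (normc_Im (x - y)); case: x => ? ?; case: y.
pose l : Cx R := (limn (@complex.Re R \o u)) +i* (limn (@complex.Im R \o u)).
have ul : u @ \oo --> l.
  apply/cvg_normcP => e e0.
  have e2 : 0 < e / 2 by rewrite divr_gt0.
  have /cvgrPdist_lt /(_ _ e2) [n1 _ h1] := cRe.
  have /cvgrPdist_lt /(_ _ e2) [n2 _ h2] := cIm.
  exists (maxn n1 n2) => n; rewrite geq_max => /andP[nn1 nn2].
  have := h1 n nn1; have := h2 n nn2; rewrite /= => a1 a2.
  rewrite normcB /l; case: (u n) a1 a2 => a b /= a1 a2.
  apply: le_lt_trans (normc_le_sum _ _) _; rewrite [ltRHS](splitr e).
  exact: ltrD.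
exists l => // N; apply/ler_addgt0Pr => e e0.
have /cvg_normcP /(_ _ e0) [n0 hn] := ul.
(* The rate survives the limit: the hypothesis bounds the second difference for every index beyond
   [N]. *)
have -> : u N - l = (u (N + n0)%N - l) - (u (N + n0)%N - u N) by ring.
apply: le_trans (normcD _ _) _; rewrite normcNE addrC lerD //.
by apply/ltW/hn; rewrite leq_addl.
Qed.
End Norm.

(** Real numbers greater than 1, whose squares are then greater than 1 too. *)
Lemma perturbation_sequence (R : realType) :
  exists t : nat -> Cx R, [/\ t @ \oo --> (1 : Cx R), forall k, t k != 0 & forall k, t k ^+ 2 != 1].
Proof.
pose t (k : nat) : Cx R := (1 + k.+1%:R^-1)%:C; exists t.
have t1 k : 1 < 1 + k.+1%:R^-1 :> R by rewrite ltrDl invr_gt0.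
split=> [|k|k].
- apply/cvg_normcP => e e0; exists (Num.truncn e^-1) => k hk.
  have -> : t k - 1 = (k.+1%:R^-1)%:C by rewrite /t rmorphD /= addrC addKr.
  rewrite /= expr0n /= addr0 sqrtr_sqr ger0_norm ?invr_ge0 //.
  rewrite invf_plt ?posrE //; apply: lt_le_trans (truncnS_gt _) _.
  by rewrite ler_nat ltnS.
- by rewrite /t (fmorph_eq0 (real_complex R)) gt_eqF // (lt_trans ltr01).
- rewrite /t -rmorphXn /= -(rmorph1 (real_complex R)) (inj_eq (@complexI R)).
  by rewrite gt_eqF // exprn_egt1.
Qed.

Local Close Scope classical_set_scope.
Local Close Scope complex_scope.
Unset Implicit Arguments.

Theorem corollary5p3 (R : realType) (p q : R[i]) (hp : `|p| < 1) (hq : q != 0)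
    (n : nat) (hn : (1 <= n)%N) (m : 'I_n -> nat)
    (a b c d e : R[i]) (z : 'I_n -> R[i])
    (ha : a != 0) (hb : b != 0) (hc : c != 0) (hd : d != 0) (he : e != 0)
    (hz : forall k, z k != 0)
    (hbal : a ^+ 2 * q ^+ (1 + \sum_(k < n) m k) = b * c * d * e)
    (* no denominator vanishes; here i stands for |y| or y_k *)
    (hDelta : evandermonde p z != 0)
    (htheta : forall k, theta p (a * z k) != 0)
    (hde : forall i, (i <= \sum_(k < n) m k)%N ->
       epochs p q [:: a * q / d; a * q / e] i != 0)
    (haq : forall j i, (i <= \sum_(k < n) m k)%N ->
       epoch p q (a * q ^+ (1 + m j) * z j) i != 0)
    (hbc : forall k i, (i <= m k)%N ->
       epochs p q [:: a * q * z k / b; a * q * z k / c] i != 0)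
    (hqz : forall j k i, (i <= m k)%N -> epoch p q (q * z k / z j) i != 0)
    (hrhs : epochs p q [:: a * q / d; a * q / (b * c * d)]
              (\sum_(k < n) m k) != 0) :
  \sum_(y : {dffun forall k : 'I_n, 'I_(m k).+1})
    (let w := (\sum_(k < n) y k)%N in
     evandermonde p (fun k => z k * q ^+ y k) / evandermonde p z
     * (\prod_(k < n) (theta p (a * z k * q ^+ (y k + w)) / theta p (a * z k)))
     * (epochs p q [:: b; c] w / epochs p q [:: a * q / d; a * q / e] w)
     * (\prod_(j < n)
          (epoch p q (a * z j) w / epoch p q (a * q ^+ (1 + m j) * z j) w))
     * q ^+ w
     * (\prod_(k < n)
          (epochs p q [:: d * z k; e * z k] (y k)
           / epochs p q [:: a * q * z k / b; a * q * z k / c] (y k)))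
     * (\prod_(j < n) \prod_(k < n)
          (epoch p q (q ^- m j * z k / z j) (y k)
           / epoch p q (q * z k / z j) (y k))))
  = epochs p q [:: a * q / (c * d); a * q / (b * d)] (\sum_(k < n) m k)
    / epochs p q [:: a * q / d; a * q / (b * c * d)] (\sum_(k < n) m k)
    * \prod_(k < n)
        (epochs p q [:: a * q * z k; a * q * z k / (b * c)] (m k)
         / epochs p q [:: a * q * z k / b; a * q * z k / c] (m k)).
Proof.
have p1 : normc p < 1 by move: hp; rewrite normE -(ltcR (normc p) 1).
have [t [t_cvg t0 t1]] := perturbation_sequence R.
have nM : forall x y : Cx R, normc (x * y) = normc x * normc y := @normcM R.
have nD : forall x y : Cx R, normc (x + y) <= normc x + normc y := @normcD R.
have nN : forall x : Cx R, normc (- x) = normc x := @normcNE R.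
have nC := @cvg_normcP R; have nG := @geometric_cvg R.
have n0 := @normc_ge0 R; have n1 := @normc_eq0 R.
have f1 := @theta_inv (Cx R) R _ nM nD nN n0 n1 nC nG p p1.
have f2 := @theta1 (Cx R) R _ nM nD nN n0 n1 nC nG p p1.
have f3 := @theta_three_term (Cx R) R _ nM nD nN n0 n1 nC nG p p1.
have f4 := @theta_seq_continuous (Cx R) R _ nM nD nN n0 n1 nC nG p p1.
have f5 := @theta_isolated_zeros (Cx R) R _ nM nD nN n0 n1 nC nG p p1.
have main := @jackson_sum (Cx R) p q hq f1 f2 f3 f4 f5 t t_cvg t0 t1 n m a b c d e z.
exact: (main ha hb hc hd he hz hbal hDelta htheta hde haq hbc hqz).
Qed.
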